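(* Let $G$ be an AH-algebra (the directed group of an e-ring $(R,E)$) with set of projections $P$, and let $H$ be a C-block in $G$. Then $(R,E\cap H)$ is an e-ring with directed group $H$, the e-ring partial order on $H$ is the partial order induced from $G$, the set of projections in $H$ is a block $B$ in $P$, $H=C(B)$, and $H$ is an AH-algebra with the Vigier property. Moreover, under the $1$-norm $\|\cdot\|$, $H$ is a commutative and associative real Banach algebra with unity element $1$ and with the property that $\|h^2\|=\|h\|^2$ for all $h\in H$.
   Context: **e-rings.** An e-ring is a pair $(R,E)$ where $R$ is an associative ring with unity $1\neq 0$ and $E\subseteq R$ is a subset (elements called effects) such that $0,1\in E$; $e\in E\Rightarrow 1-e\in E$; and the set $E^{+}$ of all finite sums $e_1+\cdots+e_n$ with $e_i\in E$ satisfies, for all $a,b\in E^{+}$: (i) $-a\in E^{+}\Rightarrow a=0$; (ii) $1-a\in E^{+}\Rightarrow a\in E$; (iii) $ab=ba\Rightarrow ab\in E^{+}$; (iv) $aba\in E^{+}$; (v) $aba=0\Rightarrow ab=ba=0$; (vi) $(a-b)^2\in E^{+}$. The directed group of $(R,E)$ is $G:=E^{+}-E^{+}=\{a-b: a,b\in E^{+}\}$, a subgroup of the additive group of $R$, with the e-ring partial order $g\leq h\Leftrightarrow h-g\in E^{+}$. The set of projections in $G$ is $P:=\{p\in G: p=p^2\}$. Products of elements of $G$ are taken in $R$. **Commutants.** For $g,h\in G$, $gCh$ means $gh=hg$. For $A\subseteq G$, $C(A):=\{g\in G: gCa\ \forall a\in A\}$ and $CC(A):=C(C(A))$ (commutants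 are always formed in the directed group under consideration). **AH-algebra and Vigier property.** The directed group $G$ of an e-ring is an AH-algebra iff: (1) there is an effect $\frac12\in E$ with $\frac12+\frac12=1$; (2) quadratic annihilation (QA): for all $g,h\in G$, $gh^2g=0\Rightarrow gh=hg=0$; (3) commutative Vigier (CV) property: every ascending sequence $g_1\leq g_2\leq\cdots$ of pairwise commuting elements of $G$ that is bounded above in $G$ has a supremum $g$ in $G$, and $g\in CC(\{g_n:n\in\mathbb N\})$. $G$ has the Vigier (V) property iff every ascending sequence $g_1\leq g_2\leq\cdots$ in $G$ that is bounded above in $G$ has a supremum $g$ in $G$ and $g\in CC(\{g_n:n\in\mathbb N\})$. An AH-algebra $G$ is always regarded as an archimedean partially ordered real vector space (it admits a compatible real vector space structure extending its ordered group structure, with $0\le\lambda$ and $0\le g$ implying $0\le\lambda g$; with the product $\frac12(gh+hg)$ it is a real Jordan algebra). The $1$-norm on $G$ is $\|g\|:=\inf\{\lambda\in\mathbb R: 0\leq\lambda\text{ and }-\lambda\cdot 1\leq g\leq\lambda\cdot 1\}$. In an AH-algebra, $P$ is an orthomodular lattice with orthocomplementation $p\mapsto 1-p$. **Blocks and C-blocks.** Elements $p,q\in P$ are (Mackey) compatible iff there are pairwise orthogonal $p_1,q_1,r\in P$ (orthogonal: $p\le 1-q$) with $p=p_1\vee r=p_1+r$ and $q=q_1\vee r=q_1+r$; in the present setting this is equivalent to $pq=qp$. A block of $P$ is a maximal set of pairwise compatible elements of $P$; equivalently, a subset $B\subseteq P$ with $B=C(B)\cap P$. A C-block in $G$ is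 a subgroup of $G$ of the form $C(B)$ where $B$ is a block in $P$. The projections in $H$ are the elements $p\in H$ with $p=p^2$. *)

(* Defs.v *)
From HB Require Import structures.
From mathcomp Require Import all_boot all_order all_algebra.
From mathcomp Require Import boolp classical_sets functions reals.
From mathcomp Require Import topology normedtype sequences.

Set Implicit Arguments.
Unset Strict Implicit.
Unset Printing Implicit Defensive.

Import Order.TTheory GRing.Theory Num.Theory.
Import numFieldNormedType.Exports.

Local Open Scope classical_set_scope.
Local Open Scope ring_scope.

(* An e-ring is a ring R with a distinguished set E : set R.  The directed    *)
(* group and the subsets considered below are sets of elements of R, and all  *)
(* products are taken in R.                                                   *)
Section ERing.
Context {R : nzRingType}.
Implicit Types (E A B : set R) (g h p q : R).

(* The empty sum (n = 0) is allowed; this changes nothing when 0 is in E. *)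
Definition eplus E : set R :=
  [set x | exists (n : nat) (e : 'I_n -> R),
     (forall i, E (e i)) /\ x = \sum_(i < n) e i].

Record is_ering E : Prop := {
  ering0 : E 0;
  ering1 : E 1;
  ering_compl : forall e, E e -> E (1 - e);
  ering_pointed : forall a, eplus E a -> eplus E (- a) -> a = 0;
  ering_effect : forall a, eplus E a -> eplus E (1 - a) -> E a;
  ering_mul : forall a b,
    eplus E a -> eplus E b -> a * b = b * a -> eplus E (a * b);
  ering_quad : forall a b, eplus E a -> eplus E b -> eplus E (a * b * a);
  ering_quad0 : forall a b,
    eplus E a -> eplus E b -> a * b * a = 0 -> a * b = 0 /\ b * a = 0;
  ering_sqr : forall a b, eplus E a -> eplus E b -> eplus E ((a - b) ^+ 2)
}.

Definition dirgroup E : set R :=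
  [set g | exists a b, [/\ eplus E a, eplus E b & g = a - b]].

Definition ele E g h : Prop := eplus E (h - g).

Definition idempotents_in A : set R := [set p | A p /\ p = p ^+ 2].

Definition projections E : set R := idempotents_in (dirgroup E).

Definition commutant E A : set R :=
  [set g | dirgroup E g /\ forall a, A a -> g * a = a * g].

Definition bicommutant E A : set R := commutant E (commutant E A).

(* x is the supremum, computed in S, of the set A. *)
Definition is_sup_in E (S A : set R) (x : R) : Prop :=
  [/\ S x, (forall a, A a -> ele E a x)
    & forall y, S y -> (forall a, A a -> ele E a y) -> ele E x y].

Definition orthogonal E p q : Prop := ele E p (1 - q).

(* Mackey compatibility; the join of two projections is taken in P. *)
Definition compatible E p q : Prop :=
  exists p1 q1 r,
    [/\ projections E p1, projections E q1 & projections E r] /\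
    [/\ orthogonal E p1 q1, orthogonal E p1 r & orthogonal E q1 r] /\
    (is_sup_in E (projections E) [set p1; r] p /\ p = p1 + r) /\
    (is_sup_in E (projections E) [set q1; r] q /\ q = q1 + r).

Definition pairwise_compatible E B : Prop :=
  forall p q, B p -> B q -> compatible E p q.

Definition is_block E B : Prop :=
  [/\ B `<=` projections E, pairwise_compatible E B
    & forall B', B' `<=` projections E -> pairwise_compatible E B' ->
        B `<=` B' -> B' = B].

(* A commutant is always a subgroup of the directed group. *)
Definition is_cblock E (H : set R) : Prop :=
  exists B, is_block E B /\ H = commutant E B.

Definition ascending_bounded E (u : nat -> R) : Prop :=
  [/\ (forall n, dirgroup E (u n)), (forall n, ele E (u n) (u n.+1))
    & exists2 b, dirgroup E b & forall n, ele E (u n) b].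

Definition has_bicommuting_sup E (u : nat -> R) : Prop :=
  exists g, is_sup_in E (dirgroup E) (range u) g /\
            bicommutant E (range u) g.

Definition commutative_vigier E : Prop :=
  forall u : nat -> R, ascending_bounded E u ->
    (forall m n, u m * u n = u n * u m) -> has_bicommuting_sup E u.

Definition vigier E : Prop :=
  forall u : nat -> R, ascending_bounded E u -> has_bicommuting_sup E u.

Record is_AH_algebra E : Prop := {
  AH_half : exists2 h, E h & h + h = 1;
  AH_quad_annihilation : forall g h, dirgroup E g -> dirgroup E h ->
    g * h ^+ 2 * g = 0 -> g * h = 0 /\ h * g = 0;
  AH_commutative_vigier : commutative_vigier E
}.

End ERing.

Section Scaling.
Context {K : realType} {R : nzRingType}.
(* R itself need not be a K-module: the values of scal outside the subset     *)
(* under consideration are irrelevant.                                        *)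
Implicit Types (E A : set R) (scal : K -> R -> R) (nrm : R -> K).

Record is_real_vspace A scal : Prop := {
  vs0 : A 0;
  vsB : forall x y, A x -> A y -> A (x - y);
  vsZ : forall l x, A x -> A (scal l x);
  vsZDr : forall l x y, A x -> A y -> scal l (x + y) = scal l x + scal l y;
  vsZDl : forall l m x, A x -> scal (l + m) x = scal l x + scal m x;
  vsZA : forall l m x, A x -> scal l (scal m x) = scal (l * m) x;
  vs1Z : forall x, A x -> scal 1 x = x
}.

(* A real vector space structure on the directed group of (R, E), compatible  *)
(* with its ordered group structure.                                          *)
Record ordered_scaling E scal : Prop := {
  os_vspace : is_real_vspace (dirgroup E) scal;
  os_pos : forall l g, 0 <= l -> dirgroup E g -> ele E 0 g ->
    ele E 0 (scal l g)
}.

Definition one_norm E scal (g : R) : K :=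
  inf [set l : K | [/\ 0 <= l, ele E (- scal l 1) g & ele E g (scal l 1)]].

Definition norm_complete A nrm : Prop :=
  forall u : nat -> R, (forall n, A (u n)) ->
    (forall e : K, 0 < e -> exists N, forall m n,
       (N <= m)%N -> (N <= n)%N -> nrm (u m - u n) < e) ->
    exists2 x, A x & (fun n => nrm (u n - x)) @ \oo --> (0 : K).

Record is_comm_Banach_algebra A scal nrm : Prop := {
  ba_vspace : is_real_vspace A scal;
  ba1 : A 1;
  baM : forall x y, A x -> A y -> A (x * y);
  baMC : forall x y, A x -> A y -> x * y = y * x;
  baMA : forall x y z, A x -> A y -> A z -> x * (y * z) = x * y * z;
  ba_scalAl : forall l x y, A x -> A y -> scal l (x * y) = scal l x * y;
  ba_scalAr : forall l x y, A x -> A y -> scal l (x * y) = x * scal l y;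
  ba_norm_eq0 : forall x, A x -> nrm x = 0 -> x = 0;
  ba_normZ : forall l x, A x -> nrm (scal l x) = `|l| * nrm x;
  ba_normD : forall x y, A x -> A y -> nrm (x + y) <= nrm x + nrm y;
  ba_normM : forall x y, A x -> A y -> nrm (x * y) <= nrm x * nrm y;
  ba_norm1 : nrm 1 = 1;
  ba_complete : norm_complete A nrm
}.

End Scaling.

(* Main.v *)
(* The heart of the matter is that C(B) is commutative.  Given g in G with    *)
(* 0 <= g <= 1, commutative Vigier suprema of polynomials in g yield |2g - 1| *)
(* and the carrier p of the positive part of 2g - 1; this projection p lies   *)
(* in CC(g) and 0 <= 2g - p <= 1.  Iterating, g is the supremum of a binary   *)
(* expansion whose digits are projections in CC(g), so every element of G     *)
(* commuting with these projections commutes with g.  If g is in C(B), these  *)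
(* projections commute with B, hence belong to B by maximality, hence         *)
(* commute with C(B).                                                         *)
(* For the real structure, l in K is mapped to the supremum of the dyadic     *)
(* multiples of 1 below l 1, which is central in G; every compatible scaling  *)
(* is multiplication by this element.                                         *)

(* Commutativity of [H = C(B)] ([block_commutant_commute]) drives the rest. An ascending bounded
   sequence in [H] consists of commuting elements, so it has a supremum in [G]; this supremum
   commutes with [B] and therefore stays in [H] ([cblock_sup]), which gives the Vigier property.
   Halving turns a positive element of [H] into a sum of effects in [H] ([eplus_cblock]), so
   positivity, order and directed group restrict from [G] to [H].

   By the archimedean property the infimum defining the 1-norm is attained ([one_norm_leP]):
   [norm g <= l] says that [g] lies between [- l] and [l]. Submultiplicativity then becomes
   positivity of products of commuting elements, the identity for squares rests on 2 l g <= l^2 +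
   g^2, and completeness comes from shifting a fast Cauchy subsequence so that it ascends
   ([cblock_complete]). Since a compatible scaling is always multiplication by [of_real]
   ([ordered_scaling_unique]), one scaling represents all. *)
Require Import Defs.
From HB Require Import structures.
From mathcomp Require Import all_boot all_order all_algebra.
From mathcomp Require Import boolp classical_sets functions reals.
From mathcomp Require Import topology normedtype sequences.
From mathcomp Require Import ring.

Set Implicit Arguments.
Unset Strict Implicit.
Unset Printing Implicit Defensive.

Import Order.TTheory GRing.Theory Num.Theory.
Import numFieldNormedType.Exports.

Local Open Scope classical_set_scope.
Local Open Scope ring_scope.

(** * Commuting elements and orders of e-rings *)

Section CommutingElements.
Context {R : nzRingType}.
Implicit Types (x y z : R) (s : seq R).

(* Identities between commuting elements are proved by the [ring] tactic in a *)
(* commutative ring mapping onto the subring which these elements generate.   *)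
Lemma comm_eval s : {in s &, forall x y, x * y = y * x} ->
  exists (T : comNzRingType) (f : {rmorphism T -> R}),
    (forall x, x \in s -> exists X, f X = x) /\
    (forall y, (forall x, x \in s -> y * x = x * y) ->
       forall X, y * f X = f X * y).
Proof.
elim: s => [_|x s IHs xsC].
  exists int, (intmul 1); split=> // y _ X; exact: commr_int.
have [|T [f [fs fC]]] := IHs.
  by move=> y z ys zs; apply: xsC; rewrite inE ?ys ?zs orbT.
have cfx : commr_rmorph f x.
  move=> X; apply: fC => y ys.
  by apply: xsC; rewrite inE ?eqxx ?ys ?orbT.
(* The new element [x] is adjoined as an indeterminate; evaluation at [x] is a ring morphism because
   [x] commutes with the image of [f]. *)
exists {poly T}, (horner_morph cfx); split=> [y|y yC X].
  rewrite inE => /orP[/eqP->|/fs[Y <-]].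
    by exists 'X; exact: horner_morphX.
  by exists Y%:P; exact: horner_morphC.
rewrite /= /horner_morph horner_coef mulr_sumr mulr_suml; apply: eq_bigr => i _.
have yx : GRing.comm y x by apply: yC; rewrite inE eqxx.
rewrite coef_map -mulrA (mulrA y) fC; last first.
  by move=> z zs; apply: yC; rewrite inE zs orbT.
by rewrite -!mulrA (commrX i yx).
Qed.

Lemma comm_eval1 x :
  exists (T : comNzRingType) (f : {rmorphism T -> R}) X, f X = x.
Proof.
have [|T [f [fs _]]] := @comm_eval [:: x].
  by move=> y z; rewrite !inE => /eqP-> /eqP->.
by have [|X fX] := fs x; [rewrite inE|exists T, f, X].
Qed.

Lemma comm_eval2 x y : x * y = y * x ->
  exists (T : comNzRingType) (f : {rmorphism T -> R}) X Y, f X = x /\ f Y = y.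
Proof.
move=> xy; have [|T [f [fs _]]] := @comm_eval [:: x; y].
  by move=> ? ?; rewrite !inE => /orP[] /eqP-> /orP[] /eqP->.
have [|X fX] := fs x; first by rewrite inE eqxx.
have [|Y fY] := fs y; first by rewrite !inE eqxx orbT.
by exists T, f, X, Y.
Qed.

End CommutingElements.

Ltac ring_morph f :=
  rewrite -?[0](rmorph0 f) -?[1](rmorph1 f);
  rewrite -?(rmorphM f, rmorphB f, rmorphD f, rmorphN f,
             rmorphXn f, rmorphMn f);
  congr (f _); ring.

Ltac comm_ring1 x :=
  let T := fresh "T" in let f := fresh "f" in let X := fresh "X" in
  have [T [f [X <-]]] := comm_eval1 x; ring_morph f.

Ltac comm_ring2 xy :=
  let T := fresh "T" in let f := fresh "f" in
  let X := fresh "X" in let Y := fresh "Y" in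
  have [T [f [X [Y [<- <-]]]]] := comm_eval2 xy; ring_morph f.

(* Maps [{poly int}] onto the subgroup spanned by [s], so that [ring] also    *)
(* proves identities in an abelian group.                                     *)
Definition linear_eval (V : zmodType) (s : seq V) (p : {poly int}) : V :=
  \sum_(i < size s) s`_i *~ p`_i.

Fact linear_eval_is_zmod_morphism (V : zmodType) (s : seq V) :
  zmod_morphism (linear_eval s).
Proof.
move=> p q; rewrite -sumrB; apply: eq_bigr => i _.
by rewrite coefB mulrzBr.
Qed.

HB.instance Definition _ (V : zmodType) (s : seq V) :=
  GRing.isZmodMorphism.Build {poly int} V (linear_eval s)
    (linear_eval_is_zmod_morphism s).

Lemma linear_evalXn (V : zmodType) (s : seq V) i : (i < size s)%N ->
  linear_eval s 'X^i = s`_i.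
Proof.
move=> si; rewrite /linear_eval (bigD1 (Ordinal si)) //=.
rewrite coefXn eqxx big1 ?addr0 //.
by move=> j; rewrite -val_eqE /= coefXn => /negPf->.
Qed.

Lemma linear_eval5 (V : zmodType) (x y z w t : V) :
  exists (f : {additive {poly int} -> V}) X Y Z W T,
  [/\ f X = x, f Y = y, f Z = z, f W = w & f T = t].
Proof.
pose s := [:: x; y; z; w; t].
exists (linear_eval s), 'X^0, 'X^1, 'X^2, 'X^3, 'X^4.
by split; [exact: (@linear_evalXn V s 0)|exact: (@linear_evalXn V s 1)|
           exact: (@linear_evalXn V s 2)|exact: (@linear_evalXn V s 3)|
           exact: (@linear_evalXn V s 4)].
Qed.

Ltac linear5 x y z w t :=
  let f := fresh "f" in
  let X := fresh "X" in let Y := fresh "Y" in let Z := fresh "Z" in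
  let W := fresh "W" in let T := fresh "T" in
  let eX := fresh "eX" in let eY := fresh "eY" in let eZ := fresh "eZ" in
  let eW := fresh "eW" in let eT := fresh "eT" in
  have [f [X [Y [Z [W [T [eX eY eZ eW eT]]]]]]] := linear_eval5 x y z w t;
  rewrite -?eX -?eY -?eZ -?eW -?eT -?[0](raddf0 f);
  rewrite -?(raddfB f, raddfD f, raddfN f, raddfMn f); congr (f _); ring.

Ltac linear4 x y z w := linear5 x y z w w.
Ltac linear3 x y z := linear5 x y z z z.

(** * Positive cone, order and directed group of an e-ring *)

Section ERing.
Context {R : nzRingType} {E : set R} (hE : is_ering E).
Implicit Types (a b g h p q x y : R).
Local Notation pos := (eplus E).
Local Notation G := (dirgroup E).

Lemma pos0 : pos 0.
Proof.
exists 0%N, (fun=> 0); split; last by rewrite big_ord0.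
by case.
Qed.

Lemma pos_effect e : E e -> pos e.
Proof. by move=> Ee; exists 1%N, (fun=> e); rewrite big_ord1. Qed.

Lemma posD a b : pos a -> pos b -> pos (a + b).
Proof.
move=> [m [e [Ee ->]]] [n [e' [Ee' ->]]].
exists (m + n)%N, (fun i : 'I_(m + n) =>
  match fintype.split i with inl j => e j | inr j => e' j end).
split=> [i|]; first by case: (fintype.split i).
rewrite big_split_ord /=; congr (_ + _); apply: eq_bigr => i _.
  by rewrite (unsplitK (inl i)).
by rewrite (unsplitK (inr i)).
Qed.

Lemma posMn a n : pos a -> pos (a *+ n).
Proof.
move=> a0; elim: n => [|n IHn]; first by rewrite mulr0n; exact: pos0.
by rewrite mulrS; exact: posD.
Qed.

Lemma pos1 : pos 1. Proof. exact/pos_effect/(ering1 hE). Qed.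

Lemma pos_nat n : pos n%:R. Proof. exact/posMn/pos1. Qed.

Lemma ele_trans y x z : ele E x y -> ele E y z -> ele E x z.
Proof. by rewrite /ele => xy yz; have := posD yz xy; rewrite addrA subrK. Qed.

Lemma ele_anti x y : ele E x y -> ele E y x -> x = y.
Proof.
rewrite /ele => xy yx; apply/esym/eqP; rewrite -subr_eq0; apply/eqP.
by apply: (ering_pointed hE) xy _; rewrite opprB.
Qed.

Lemma ele_nat m n : (m <= n)%N -> ele E m%:R n%:R.
Proof. by move=> mn; rewrite /ele -natrB //; exact: pos_nat. Qed.

(** Effects are at most 1, so a sum of [n] effects is at most [n]: the unity is an order unit. *)
Lemma pos_bound a : pos a -> exists n, ele E a n%:R.
Proof.
move=> [n [e [Ee ->]]]; exists n; rewrite /ele.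
elim: n e Ee => [|n IHn] e Ee; first by rewrite big_ord0 subrr; exact: pos0.
rewrite big_ord_recr -natr1 opprD addrACA; apply: posD; first exact: IHn.
exact/pos_effect/(ering_compl hE).
Qed.

Lemma G_pos a : pos a -> G a.
Proof. by move=> a0; exists a, 0; rewrite subr0; split=> //; exact: pos0. Qed.

Lemma G0 : G 0. Proof. exact/G_pos/pos0. Qed.
Lemma G1 : G 1. Proof. exact/G_pos/pos1. Qed.

Lemma GB g h : G g -> G h -> G (g - h).
Proof.
move=> [a [b [a0 b0 ->]]] [c [d [c0 d0 ->]]].
exists (a + d), (b + c); split; [exact: posD|exact: posD|].
by rewrite opprB opprD addrACA.
Qed.

Lemma GN g : G g -> G (- g).
Proof. by move=> /(GB G0); rewrite sub0r. Qed.

Lemma GD g h : G g -> G h -> G (g + h).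
Proof. by move=> Gg /GN /(GB Gg); rewrite opprK. Qed.

Lemma GMn g n : G g -> G (g *+ n).
Proof.
move=> Gg; elim: n => [|n IHn]; first exact: G0.
by rewrite mulrS; exact: GD.
Qed.

Lemma G_nat n : G n%:R. Proof. exact/GMn/G1. Qed.

Lemma G_bound g : G g -> exists n, ele E g n%:R.
Proof.
move=> [a [b [a0 b0 ->]]]; have [n an] := pos_bound a0.
exists n; rewrite /ele opprB addrCA addrC; exact: posD.
Qed.

Lemma G_bound2 g : G g -> exists n, ele E g n%:R /\ ele E (- g) n%:R.
Proof.
move=> Gg; have [m gm] := G_bound Gg; have [n gn] := G_bound (GN Gg).
exists (m + n)%N; split; last first.
  by apply: ele_trans gn (ele_nat _); exact: leq_addl.
by apply: ele_trans gm (ele_nat _); exact: leq_addr.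
Qed.

Lemma pos_sqr g : G g -> pos (g * g).
Proof. by move=> [a [b [a0 b0 ->]]]; rewrite -expr2; exact: (ering_sqr hE). Qed.

Lemma pos_idem p : G p -> p * p = p -> pos p.
Proof. by move=> Gp <-; exact: pos_sqr. Qed.

Lemma idem_compl p : p * p = p -> (1 - p) * (1 - p) = 1 - p.
Proof. by move=> pp; rewrite mulrBr mulr1 mulrBl mul1r pp subrr subr0. Qed.

Lemma pos_idem_compl p : G p -> p * p = p -> pos (1 - p).
Proof. by move=> Gp pp; apply: pos_idem (idem_compl pp); exact/GB/Gp/G1. Qed.

Lemma posM a b : pos a -> pos b -> a * b = b * a -> pos (a * b).
Proof. exact: (ering_mul hE). Qed.

(** Since [p * a * p] is always positive, the hypothesis forces it to vanish, and the e-ring axiom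
    on such products splits it. *)
Lemma pos_sandwich0 p a : pos p -> pos a -> pos (- (p * a * p)) ->
  p * a = 0 /\ a * p = 0.
Proof.
move=> p0 a0 npap; apply: (ering_quad0 hE) => //.
by apply: (ering_pointed hE) npap; exact: (ering_quad hE).
Qed.

End ERing.

(** * Halves, suprema and the archimedean property *)

Section AHAlgebra.
Context {R : nzRingType} {E : set R} (hE : is_ering E) (hG : is_AH_algebra E).
Implicit Types (a b e f g h p q x y : R) (u : nat -> R).
Local Notation pos := (eplus E).
Local Notation G := (dirgroup E).

(** Chosen once from the existence statement [AH_half], so the default 0 is never returned. *)
Definition onehalf : R := xget 0 [set h | E h /\ h + h = 1].

Lemma half_spec : E onehalf /\ onehalf + onehalf = 1.
Proof.
have [h Eh h2] := AH_half hG.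
by apply: (@xgetPex _ 0 [set h | E h /\ h + h = 1]); exists h.
Qed.

Lemma pos_half1 : pos onehalf.
Proof. by apply: pos_effect; case: half_spec. Qed.

Lemma onehalf_double x : onehalf * x + onehalf * x = x.
Proof. by rewrite -mulrDl half_spec.2 mul1r. Qed.

Lemma subr_half y x : y - onehalf * x = onehalf * (y + y - x).
Proof. by rewrite mulrBr mulrDr onehalf_double. Qed.

(** Both sides equal [onehalf * x * onehalf] added to itself; hence [onehalf] is central in all of
    [R]. *)
Lemma halfC x : onehalf * x = x * onehalf.
Proof.
have -> : onehalf * x = onehalf * x * onehalf + onehalf * x * onehalf.
  by rewrite -mulrDr half_spec.2 mulr1.
by rewrite -mulrA onehalf_double.
Qed.

Lemma halfXC n x : onehalf ^+ n * x = x * onehalf ^+ n.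
Proof. exact/commr_sym/commrX/commr_sym/halfC. Qed.

Lemma halfX_double n x : onehalf ^+ n * x *+ 2 ^ n = x.
Proof.
elim: n => [|n IHn]; first by rewrite expr0 mul1r expn0 mulr1n.
by rewrite exprS -mulrA expnS mulrnA mulr2n onehalf_double.
Qed.

Lemma pos_half a : pos a -> pos (onehalf * a).
Proof. by move=> a0; apply: (posM hE) (halfC a); first exact: pos_half1. Qed.

Lemma pos_halfX n a : pos a -> pos (onehalf ^+ n * a).
Proof.
elim: n a => [|n IHn] a a0; first by rewrite mul1r.
by rewrite exprSr -mulrA; exact/IHn/pos_half.
Qed.

Lemma pos_pow2 n x : pos (x *+ 2 ^ n) -> pos x.
Proof. by move/(pos_halfX n); rewrite mulrnAr halfX_double. Qed.

Lemma pos_double x : pos (x + x) -> pos x.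
Proof. by rewrite -mulr2n; exact: (@pos_pow2 1). Qed.

Lemma G_half g : G g -> G (onehalf * g).
Proof.
move=> [a [b [a0 b0 ->]]]; exists (onehalf * a), (onehalf * b).
by rewrite mulrBr; split=> //; exact: pos_half.
Qed.

Lemma G_halfX n g : G g -> G (onehalf ^+ n * g).
Proof.
elim: n g => [|n IHn] g Gg; first by rewrite mul1r.
by rewrite exprSr -mulrA; exact/IHn/G_half.
Qed.

(** Polarization: the product is half a combination of squares, and squares of elements of [G] are
    positive. *)
Lemma GM g h : G g -> G h -> g * h = h * g -> G (g * h).
Proof.
move=> Gg Gh gh.
have -> : g * h = onehalf * ((g + h) * (g + h) - g * g - h * h).
  have -> : (g + h) * (g + h) - g * g - h * h = g * h + g * h by comm_ring2 gh.
  by rewrite mulrDr onehalf_double.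
by apply: G_half; do 2?apply: GB; apply/G_pos/(pos_sqr hE) => //; exact: GD.
Qed.

(** The working form of the commutative Vigier property: membership in the bicommutant is read as
    inheriting every commutation that the whole sequence satisfies. *)
Lemma monotone_sup u b :
  (forall n, G (u n)) -> (forall n, pos (u n.+1 - u n)) ->
  G b -> (forall n, pos (b - u n)) -> (forall m n, u m * u n = u n * u m) ->
  exists g, [/\ G g, forall n, pos (g - u n),
    forall y, G y -> (forall n, pos (y - u n)) -> pos (y - g) &
    forall h, G h -> (forall n, h * u n = u n * h) -> h * g = g * h].
Proof.
move=> Gu uS Gb ub uC.
have [|g [[Gg ug gmin] [_ gC]]] := AH_commutative_vigier hG _ uC.
  by split=> //; exists b.
exists g; split=> // [n|y Gy uy|h Gh hu].
- by apply: ug; exists n.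
- by apply: gmin => // _ [n _ <-]; exact: uy.
- by apply/esym/gC; split=> // _ [n _ <-]; exact: hu.
Qed.

(* The supremum of the sequence [- onehalf ^+ n] is 0. *)
Lemma archimedean x b : G x -> G b -> (forall n, ele E (x *+ 2 ^ n) b) ->
  ele E x 0.
Proof.
move=> Gx Gb xb; have [k bk] := G_bound hE Gb.
(* After multiplication by [2 ^ (n + k)] this is the chain from [x *+ 2 ^ (n + k)] to [b], to [k],
   to [2 ^ k]. *)
have xhalf n : pos (onehalf ^+ n - x).
  apply: (@pos_pow2 (n + k)); rewrite mulrnBl.
  have -> : onehalf ^+ n *+ 2 ^ (n + k) = (2 ^ k)%:R.
    by rewrite expnD mulrnA -[onehalf ^+ n]mulr1 halfX_double.
  apply: ele_trans (xb _) _; apply: ele_trans bk _.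
  by apply: (ele_nat hE); exact/ltnW/ltn_expl.
have GHn n : G (onehalf ^+ n) by rewrite -[_ ^+ _]mulr1; apply/G_halfX/(G1 hE).
have posHn n : pos (onehalf ^+ n).
  by rewrite -[_ ^+ _]mulr1; apply/pos_halfX/(pos1 hE).
have HS n : onehalf ^+ n = onehalf ^+ n.+1 + onehalf ^+ n.+1.
  by rewrite exprS onehalf_double.
have [n|n||n|m n|s [Gs us smin _]] := @monotone_sup (fun n => - onehalf ^+ n) 0.
- exact: GN.
- by rewrite opprK addrC {1}HS addrK.
- exact: G0.
- by rewrite sub0r opprK.
- by rewrite !mulrN !mulNr halfXC.
have s0 : s = 0.
  apply: (ering_pointed hE); last first.
    rewrite -sub0r; apply: smin => [|n]; first exact: G0.
    by rewrite sub0r opprK.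
  (* Each term is twice the next one, so [s + s] is also an upper bound; minimality of [s] gives
     that [s] is positive. *)
  have -> : s = s + s - s by rewrite addrK.
  apply: smin => [|n]; first exact: GD.
  by rewrite opprK HS addrACA; apply: posD; have := us n.+1; rewrite opprK.
rewrite /ele sub0r -[- x]subr0 -s0; apply: smin => [|n]; first exact: GN.
by rewrite opprK addrC.
Qed.

End AHAlgebra.

Arguments onehalf {R} E.

(** * Square roots and carriers *)

Section SpectralProjections.
Context {R : nzRingType} {E : set R} (hE : is_ering E) (hG : is_AH_algebra E).
Implicit Types (a b e f g h p q x y : R).
Local Notation pos := (eplus E).
Local Notation G := (dirgroup E).
Local Notation half := (onehalf E).

Lemma commute_mul h x y : h * x = x * h -> h * y = y * h ->
  h * (x * y) = x * y * h.
Proof. by move=> hx hy; exact: (commrM (R := R)). Qed.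

Lemma commute_add h x y : h * x = x * h -> h * y = y * h ->
  h * (x + y) = (x + y) * h.
Proof. by move=> hx hy; exact: (commrD (R := R)). Qed.

Lemma commute_sub h x y : h * x = x * h -> h * y = y * h ->
  h * (x - y) = (x - y) * h.
Proof. by move=> hx hy; exact: (commrB (R := R)). Qed.

Lemma commute_one h : h * 1 = 1 * h. Proof. by rewrite mulr1 mul1r. Qed.

Lemma commute_onehalf h x : h * x = x * h -> h * (half * x) = half * x * h.
Proof. by move=> hx; apply: commute_mul => //; rewrite (halfC hG). Qed.

Lemma pos_1Bsqr x : pos (1 - x) -> pos (1 + x) -> pos (1 - x * x).
Proof.
have -> : 1 - x * x = (1 - x) * (1 + x) by comm_ring1 x.
by move=> x1 x2; apply: (posM hE) => //; comm_ring1 x.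
Qed.

(* With [x = 1 - a], the iteration [y := (x + y ^ 2) / 2] started at 0 is     *)
(* ascending and its supremum [y] satisfies [(1 - y) ^ 2 = a].                *)
Lemma sqrt_exists a : pos a -> pos (1 - a) -> exists s,
  [/\ pos s, pos (1 - s), s * s = a &
      forall h, G h -> h * a = a * h -> h * s = s * h].
Proof.
move=> a0 a1; set x := 1 - a.
pose Y n := iter n (fun y => half * (x + y * y)) 0.
have YS n : Y n.+1 = half * (x + Y n * Y n) by [].
have YC h n : h * a = a * h -> h * Y n = Y n * h.
  move=> ha; elim: n => [|n IHn]; first by rewrite mulr0 mul0r.
  rewrite YS; apply/commute_onehalf/commute_add/commute_mul => //.
  exact/commute_sub/ha/commute_one.
have Ya n : a * Y n = Y n * a by exact: YC.
have YY m n : Y m * Y n = Y n * Y m by apply/YC/esym/Ya.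
have Y0 n : pos (Y n).
  elim: n => [|n IHn]; first exact: pos0.
  by apply/(pos_half hE hG)/posD => //; exact: (posM hE).
have Y1 n : pos (1 - Y n).
  elim: n => [|n IHn]; first by rewrite subr0; exact: (pos1 hE).
  rewrite YS (subr_half hG) opprD addrACA subKr.
  apply/(pos_half hE hG)/posD => //.
  by apply: pos_1Bsqr => //; apply/posD => //; exact: (pos1 hE).
have YD n : pos (Y n.+1 - Y n).
  elim: n => [|n IHn]; first by rewrite subr0; exact: Y0.
  rewrite 2!YS -mulrBr opprD addrACA subrr add0r.
  have -> : Y n.+1 * Y n.+1 - Y n * Y n = (Y n.+1 - Y n) * (Y n.+1 + Y n).
    by comm_ring2 (YY n.+1 n).
  apply/(pos_half hE hG)/(posM hE) => //; first exact: posD.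
  by comm_ring2 (YY n.+1 n).
have GY n : G (Y n) by exact: G_pos.
have [y [Gy Yy ymin yC]] := monotone_sup hG GY YD (G1 hE) Y1 YY.
have y0 : pos y by rewrite -[y]subr0; exact: (Yy 0%N).
have y1 : pos (1 - y) by apply: ymin => //; exact: (G1 hE).
have yY n : y * Y n = Y n * y by apply/esym/yC.
have ay : a * y = y * a by apply: yC => //; exact: G_pos.
pose z := half * (x + y * y).
have Gz : G z.
  by apply/(G_half hE hG)/GD/(GM hE hG) => //; apply/GB/G_pos/a0/(G1 hE).
have zY n : z - Y n.+1 = half * ((y - Y n) * (y + Y n)).
  rewrite YS -mulrBr opprD addrACA subrr add0r; congr (half * _).
  by comm_ring2 (yY n).
have zY0 n : pos (z - Y n.+1).
  rewrite zY; apply/(pos_half hE hG)/(posM hE) => //; first exact: posD.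
  by comm_ring2 (yY n).
have zy : z = y.
  apply: (ele_anti hE).
    rewrite /ele; have -> : y - z = y + y - z - y by rewrite addrAC addrK.
    (* The element [y + y - z] bounds every [Y n]: by [zY] the gap [z - Y n.+1] is at most
       [y - Y n], because [y + Y n] is at most 2. *)
    apply: ymin => [|n]; first exact/GB/Gz/GD.
    have -> : y + y - z - Y n = (y - Y n - (z - Y n.+1)) + (y - Y n.+1).
      by linear4 y z (Y n) (Y n.+1).
    apply: posD => //; rewrite zY.
    rewrite (subr_half hG).
    have -> : y - Y n + (y - Y n) - (y - Y n) * (y + Y n) =
              (y - Y n) * ((1 - y) + (1 - Y n)) by comm_ring2 (yY n).
    apply/(pos_half hE hG)/(posM hE) => //; first exact: posD.
    by comm_ring2 (yY n).
  apply: ymin => // n; apply: ele_trans (zY0 n); exact: YD.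
exists (1 - y); split=> //.
- by rewrite opprB addrC subrK.
- have -> : (1 - y) * (1 - y) = 1 - (y + y) + y * y by comm_ring1 y.
  have -> : y + y = 1 - a + y * y by rewrite -{1 2}zy (onehalf_double hG).
  by comm_ring2 ay.
- move=> h Gh ha; apply: commute_sub (commute_one h) _.
  by apply: yC => // n; exact: YC.
Qed.

(* The sequence [(1 - e) ^ (2 ^ n)] descends to the projection [1 - p].       *)
Lemma carrier_exists e : pos e -> pos (1 - e) -> exists p,
  [/\ G p, p * p = p, p * e = e,
      forall h, G h -> h * e = e * h -> h * p = p * h &
      forall f, pos f -> pos (1 - f) -> e * f = 0 -> f * e = 0 -> p * f = 0].
Proof.
move=> e0 e1; pose X n := iter n (fun x => x * x) (1 - e).
have XS n : X n.+1 = X n * X n by [].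
have XC h n : h * e = e * h -> h * X n = X n * h.
  move=> he; elim: n => [|n IHn]; first exact/commute_sub/he/commute_one.
  by rewrite XS; exact: commute_mul.
have XX m n : X m * X n = X n * X m by apply/XC/esym/XC.
have X0 n : pos (X n) by elim: n => [|n IHn] //; exact: (posM hE).
have X1 n : pos (1 - X n).
  elim: n => [|n IHn]; first by rewrite opprB addrC subrK.
  by apply: pos_1Bsqr => //; apply/posD => //; exact: (pos1 hE).
have XD n : pos (X n - X n.+1).
  have -> : X n - X n.+1 = X n * (1 - X n) by rewrite mulrBr mulr1.
  by apply: (posM hE) => //; exact/commute_sub/erefl/commute_one.
have GX n : G (X n) by exact: G_pos.
have [n|n|n|m n|p [Gp Xp pmin pC]] :=
    @monotone_sup _ _ hG (fun n => 1 - X n) 1 _ _ (G1 hE).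
- exact/GB/GX/(G1 hE).
- by rewrite opprB addrC addrA subrK.
- by rewrite opprB addrC subrK.
- by comm_ring2 (XX m n).
pose q := 1 - p.
have Gq : G q by exact/GB/Gp/(G1 hE).
have Xq n : pos (X n - q) by rewrite /q opprB addrCA -opprB; exact: Xp.
have qmax y : G y -> (forall n, pos (X n - y)) -> pos (q - y).
  move=> Gy Xy; rewrite /q addrAC; apply: pmin => [|n].
    exact/GB/Gy/(G1 hE).
  have -> : 1 - y - (1 - X n) = X n - y by rewrite opprB addrC addrA subrK.
  exact: Xy.
have q0 : pos q.
  by rewrite -[q]subr0; apply: qmax => [|n]; [exact: G0|rewrite subr0].
have qC h : G h -> h * e = e * h -> h * q = q * h.
  move=> Gh he; apply: commute_sub (commute_one h) _.
  by apply: pC => // n; exact/commute_sub/XC/he/commute_one.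
have Xq_comm n : X n * q = q * X n by apply/qC/esym/XC.
have q1 : pos (1 - q) by apply: ele_trans (Xq 0%N) (X1 0%N).
have Gqq : G (q * q) by exact: (GM hE hG).
have XqD n : pos (X n * X n - q * q).
  have -> : X n * X n - q * q = (X n - q) * (X n + q) by comm_ring2 (Xq_comm n).
  by apply: (posM hE) => //; [exact: posD|comm_ring2 (Xq_comm n)].
have qq : q * q = q.
  apply: (ele_anti hE).
    by apply: qmax => // n; apply: ele_trans (XqD n) (XD n).
  (* Half of the defect [d] fits below every [X n - q], so [q + half * d] is still a lower bound of
     the [X n]; as [q] is the greatest one, [d] is at most 0. *)
  set d := q - q * q; have Gd : G d by exact: GB.
  have qd n : ele E (half * d) (X n - q).
    rewrite /ele (subr_half hG).
    have -> : X n - q + (X n - q) - d =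
        (X n - q) * ((1 - X n) + (1 - q)) + (X n * X n - q).
      by rewrite /d; comm_ring2 (Xq_comm n).
    apply/(pos_half hE hG)/posD; last exact: (Xq n.+1).
    apply: (posM hE) => //; first exact: posD.
    by comm_ring2 (Xq_comm n).
  have hd0 : pos (- (half * d)).
    have -> : - (half * d) = q - (q + half * d).
      by rewrite opprD addrA subrr sub0r.
    apply: qmax => [|n]; first exact/GD/(G_half hE hG).
    by rewrite opprD addrA; exact: qd.
  by rewrite /ele -opprB -/d -[d](onehalf_double hG) opprD; exact: posD.
have pp : p * p = p by have := idem_compl qq; rewrite /q subKr.
have pe : p * e = e.
  have eq : e * q = q * e by apply: qC => //; exact: G_pos.
  have qe : q * e = 0.
    apply: (ering_pointed hE); first exact: (posM hE).
    have -> : - (q * e) = q * (1 - e - q).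
      by rewrite mulrBr qq mulrBr mulr1 addrAC subrr sub0r.
    apply: (posM hE) => //; first exact: (Xq 0%N).
    exact/commute_sub/erefl/commute_sub/esym/eq/commute_one.
  by rewrite -[p](subKr 1) -/q mulrBl mul1r qe subr0.
exists p; split=> // [h Gh he|f f0 f1 ef fe].
  by apply: pC => // n; apply/commute_sub/XC => //; exact: commute_one.
(* An [f] annihilated by [e] is fixed by every [X n], hence lies below all of them and so below
   [q = 1 - p]. *)
have Xf n : X n * f = f /\ f * X n = f.
  elim: n => [|n [IH1 IH2]]; last by rewrite XS -mulrA IH1 IH1 mulrA IH2.
  by rewrite mulrBl mulrBr ef fe mulr1 mul1r subr0.
have pf : f * p = p * f.
  apply: pC => [|n]; first exact: G_pos.
  by apply: commute_sub (commute_one f) _; rewrite (Xf n).1 (Xf n).2.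
have fq : pos (q - f).
  apply: qmax => [|n]; first exact: G_pos.
  have -> : X n - f = X n * (1 - f) by rewrite mulrBr mulr1 (Xf n).1.
  apply: (posM hE) => //.
  by rewrite mulrBr mulrBl (Xf n).1 (Xf n).2 mulr1 mul1r.
have p0 : pos p by exact: (pos_idem hE).
apply: (ering_pointed hE); first exact: (posM hE).
have -> : - (p * f) = p * (q - f).
  by rewrite mulrBr /q mulrBr pp mulr1 subrr sub0r.
apply: (posM hE) => //; apply: commute_sub => //.
exact/commute_sub/erefl/commute_one.
Qed.

(** Write [k = 2g - 1] as [a - b] with [a + b = s] its absolute value and [a * b = 0]. The carrier
    [p] of [a * a] makes [p * k] positive and [(1 - p) * k] negative, so [2g] is at least 1 on [p]
    and at most 1 on [1 - p]: [p] is a leading binary digit of [g]. *)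
Lemma binary_digit g : pos g -> pos (1 - g) -> exists p,
  [/\ G p, p * p = p, forall h, G h -> h * g = g * h -> h * p = p * h,
      pos (g + g - p) & pos (1 - (g + g - p))].
Proof.
move=> g0 g1; pose k := g + g - 1.
have Gg : G g by exact: G_pos.
have Gk : G k by exact/GB/(G1 hE)/GD.
have kC h : h * g = g * h -> h * k = k * h.
  by move=> hg; exact/commute_sub/commute_one/commute_add.
have k1 : pos (1 - k) by rewrite /k opprB opprD addrA addrACA; exact: posD.
have k2 : pos (1 + k) by rewrite /k addrC subrK; exact: posD.
have [s [s0 s1 ss sC]] := sqrt_exists (pos_sqr hE Gk) (pos_1Bsqr k1 k2).
have Gs : G s by exact: G_pos.
have ks : k * s = s * k by apply: sC => //; rewrite mulrA.
pose a := half * (s + k); pose b := half * (s - k).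
have Ga : G a by exact/(G_half hE hG)/GD.
have Gb : G b by exact/(G_half hE hG)/GB.
have aC h : G h -> h * g = g * h -> h * a = a * h.
  by move=> Gh /kC hk; apply/commute_onehalf/commute_add => //;
    exact/sC/commute_mul.
have bC h : G h -> h * g = g * h -> h * b = b * h.
  by move=> Gh /kC hk; apply/commute_onehalf/commute_sub => //;
    exact/sC/commute_mul.
have abs : s = a + b.
  by rewrite /a /b -mulrDr addrACA subrr addr0 mulrDr (onehalf_double hG).
have abk : k = a - b.
  rewrite /a /b -mulrBr; have -> : s + k - (s - k) = k + k by comm_ring2 ks.
  by rewrite mulrDr (onehalf_double hG).
have ab : a * b = b * a.
  apply: bC => //; apply/esym/aC => //.
have ab0 : a * b = 0.
  have abab : a * b + a * b + (a * b + a * b) = s * s - k * k.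
    by rewrite abs abk; comm_ring2 ab.
  rewrite -[a * b](onehalf_double hG) -mulrDr.
  rewrite -[a * b + a * b](onehalf_double hG) -mulrDr.
  by rewrite abab ss subrr !mulr0.
have a_le1 : pos (1 - a).
  rewrite /a (subr_half hG); apply: (pos_half hE hG).
  have -> : 1 + 1 - (s + k) = 1 - s + (1 - k) by comm_ring2 ks.
  exact: posD.
have a_geN1 : pos (1 + a).
  rewrite -[a]opprK /a -mulrN (subr_half hG); apply: (pos_half hE hG).
  have -> : 1 + 1 - - (s + k) = s + 1 + (1 + k) by comm_ring2 ks.
  apply: posD => //; apply: posD => //; exact: (pos1 hE).
have b_le1 : pos (1 - b).
  rewrite /b (subr_half hG); apply: (pos_half hE hG).
  have -> : 1 + 1 - (s - k) = 1 - s + (1 + k) by comm_ring2 ks.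
  exact: posD.
have b_geN1 : pos (1 + b).
  rewrite -[b]opprK /b -mulrN (subr_half hG); apply: (pos_half hE hG).
  have -> : 1 + 1 - - (s - k) = s + 1 + (1 - k) by comm_ring2 ks.
  apply: posD => //; apply: posD => //; exact: (pos1 hE).
(* The square [a * a] is used because it is positive by axiom, while for [a] only the bounds -1 and
   1 are at hand. *)
have [p [Gp pp pa pC paf]] :=
  carrier_exists (pos_sqr hE Ga) (pos_1Bsqr a_le1 a_geN1).
have {}pC h : G h -> h * g = g * h -> h * p = p * h.
  by move=> Gh hg; apply: pC => //; apply/commute_mul; exact: aC.
have pg : p * g = g * p by apply/esym/pC.
(* Quadratic annihilation passes from the squares to [a] here, and to [b] in [pb]. *)
have p1a : (1 - p) * a = 0.
  have [] // := AH_quad_annihilation hG (GB (G1 hE) Gp) Ga.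
  by rewrite expr2 mulrBl pa mul1r subrr mul0r.
have pb : p * b = 0.
  have [] // := AH_quad_annihilation hG Gp Gb.
  rewrite expr2 paf ?mul0r //; first exact: (pos_sqr hE).
  - exact: pos_1Bsqr.
  - by rewrite -mulrA (mulrA a b) ab0 mul0r mulr0.
  - by rewrite -mulrA (mulrA b a) -ab ab0 mul0r mulr0.
have p0 : pos p by exact: (pos_idem hE).
have p'0 : pos (1 - p) by exact: (pos_idem_compl hE).
have ps : p * s = s * p by apply/sC => //; apply/commute_mul; apply: kC.
have p's : (1 - p) * s = s * (1 - p).
  by apply/esym/commute_sub/esym/ps; exact: commute_one.
have pk0 : pos (p * k).
  have -> : p * k = p * s by rewrite abs abk mulrBr mulrDr pb subr0 addr0.
  exact: (posM hE).
have p'k0 : pos (- ((1 - p) * k)).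
  have -> : - ((1 - p) * k) = (1 - p) * s.
    by rewrite abs abk mulrBr mulrDr p1a sub0r add0r opprK.
  exact: (posM hE).
exists p; split=> //.
- have -> : g + g - p = p * k + ((1 - p) * g + (1 - p) * g).
    by rewrite /k; comm_ring2 pg.
  have p'g : pos ((1 - p) * g).
    apply: (posM hE) => //; apply/esym/commute_sub/esym/pg.
    exact: commute_one.
  by apply: posD => //; exact: posD.
- have -> : 1 - (g + g - p) = p * (1 - g) + p * (1 - g) + - ((1 - p) * k).
    by rewrite /k; comm_ring2 pg.
  apply: posD => //.
  have pg1 : pos (p * (1 - g)).
    by apply: (posM hE) => //; exact/commute_sub/pg/commute_one.
  exact: posD.
Qed.

End SpectralProjections.

(** * Commutativity of C-blocks *)

Section Blocks.
Context {R : nzRingType} {E : set R} (hE : is_ering E) (hG : is_AH_algebra E).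
Implicit Types (a b e f g h k p q x y : R) (B : set R).
Local Notation pos := (eplus E).
Local Notation G := (dirgroup E).
Local Notation half := (onehalf E).

(* The partial sums of the binary expansion of [g], whose digits are          *)
(* projections in CC(g), ascend to [g].                                       *)
Lemma commute_unit_of_projections g h : pos g -> pos (1 - g) -> G h ->
  (forall p, G p -> p * p = p ->
     (forall k, G k -> k * g = g * k -> k * p = p * k) -> h * p = p * h) ->
  h * g = g * h.
Proof.
move=> g0 g1 Gh hP; have Gg : G g by exact: G_pos.
(* [F] is a total digit function; its value 0 outside the unit interval is harmless, since the
   remainders [T n] never leave that interval. *)
have [|F FP] := @choice R R (fun x p => pos x -> pos (1 - x) ->
    [/\ G p, p * p = p, forall k, G k -> k * x = x * k -> k * p = p * k,
      pos (x + x - p) & pos (1 - (x + x - p))]).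
  move=> x; have [x0|x0] := pselect (pos x); last by exists 0.
  have [x1|x1] := pselect (pos (1 - x)); last by exists 0.
  by have [p] := binary_digit hE hG x0 x1; exists p.
pose T n := iter n (fun x => x + x - F x) g.
have T01 n : pos (T n) /\ pos (1 - T n).
  by elim: n => [|n [IH1 IH2]] //; have [] := FP _ IH1 IH2.
have FT n := FP _ (T01 n).1 (T01 n).2.
have TC k n : G k -> k * g = g * k -> k * T n = T n * k.
  move=> Gk kg; elim: n => [|n IHn] //=.
  have [_ _ FC _ _] := FT n; apply: commute_sub; last exact: FC.
  exact: commute_add.
have GT n : G (T n) by exact: (G_pos (T01 n).1).
pose s n := g - half ^+ n * T n.
have Gs n : G (s n) by exact/GB/(G_halfX hE hG).
have sS n : s n.+1 = s n + half ^+ n.+1 * F (T n).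
  rewrite /s -[half ^+ n * T n](onehalf_double hG) !mulrA -exprS -mulrDr -addrA.
  congr (_ + _).
  by rewrite -[T n.+1]/(T n + T n - F (T n)) mulrBr opprB addrC.
have sC k n : G k -> k * g = g * k -> k * s n = s n * k.
  move=> Gk kg; apply: commute_sub => //; apply: commute_mul; last exact: TC.
  by rewrite (halfXC hG).
have sg n : s n * g = g * s n by exact/esym/sC.
have hs n : h * s n = s n * h.
  elim: n => [|n IHn]; first by rewrite /s expr0 mul1r subrr mulr0 mul0r.
  rewrite sS; apply: commute_add IHn _; apply: commute_mul.
    by rewrite (halfXC hG).
  by have [GF FF FC _ _] := FT n; apply: hP => // k Gk kg; exact/FC/TC.
have gs n : g - s n = half ^+ n * T n by rewrite /s subKr.
have [n|n|m n|t [Gt ts tmin tC]] := monotone_sup hG Gs _ Gg.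
- rewrite sS addrAC subrr add0r; apply: (pos_halfX hE hG).
  by have [GF FF _ _ _] := FT n; exact: (pos_idem hE).
- by rewrite gs; apply: (pos_halfX hE hG) (T01 n).1.
- exact: sC.
suff <- : t = g by exact: tC.
apply: (ele_anti hE).
  by apply: tmin => // n; rewrite gs; apply: (pos_halfX hE hG) (T01 n).1.
(* [g - t] is at most [g - s n], whose multiple by [2 ^ n] is the remainder [T n], at most 1. *)
rewrite /ele -opprB -sub0r; apply: (archimedean hE hG (GB Gg Gt) (G1 hE)) => n.
apply: ele_trans (T01 n).2.
rewrite -[T n](halfX_double hG n) -gs /ele -mulrnBl; apply: posMn.
have -> : g - s n - (g - t) = t - s n by linear3 g (s n) t.
exact: ts.
Qed.

(** If [g] lies between [- n] and [n], then [g'] is an affine image of [g] in the unit interval with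
    the same commutant. *)
Lemma commute_of_projections g h : G g -> G h ->
  (forall p, G p -> p * p = p ->
     (forall k, G k -> k * g = g * k -> k * p = p * k) -> h * p = p * h) ->
  h * g = g * h.
Proof.
move=> Gg Gh hP; have [n [gn gn']] := G_bound2 hE Gg.
have Cn k : k * n%:R = n%:R * k by exact: commr_nat.
have CH k : k * half ^+ n.+1 = half ^+ n.+1 * k by rewrite (halfXC hG).
pose g' := half ^+ n.+1 * (g + n%:R).
have gE : g = g' *+ 2 ^ n.+1 - n%:R by rewrite /g' (halfX_double hG) addrK.
have gC k : k * g = g * k <-> k * g' = g' * k.
  split=> kg; first by apply: commute_mul => //; exact: commute_add.
  by rewrite gE; apply: commute_sub => //; rewrite mulrnAr mulrnAl kg.
apply/gC/commute_unit_of_projections => //.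
- by apply: (pos_halfX hE hG); move: gn'; rewrite /ele opprK addrC.
- rewrite -[1](halfX_double hG n.+1) -mulrnAr -mulrBr; apply: (pos_halfX hE hG).
  have -> : 1 *+ 2 ^ n.+1 - (g + n%:R) =
      (n%:R - g) + ((2 ^ n.+1)%:R - (n + n)%:R).
    by rewrite natrD; linear3 g (n%:R : R) ((2 ^ n.+1)%:R : R).
  apply: posD gn _; apply: (ele_nat hE).
  by rewrite expnS mul2n -addnn leq_add // ltnW // ltn_expl.
- by move=> p Gp pp pC; apply: hP => // k Gk /gC; exact: pC.
Qed.

(** * Mackey compatibility as commutation, and maximality of blocks *)

Lemma projectionsP p : projections E p <-> G p /\ p * p = p.
Proof. by split=> -[Gp pp]; split; rewrite // ?expr2 // -expr2. Qed.

(** Compressing [1 - q - p] by [q] shows that [- (q * p * q)] is positive, and [pos_sandwich0]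
    concludes. *)
Lemma orthogonal_mul p q : G p -> p * p = p -> G q -> q * q = q ->
  Defs.orthogonal E p q -> p * q = 0 /\ q * p = 0.
Proof.
move=> Gp pp Gq qq pq.
have p0 : pos p by exact: (pos_idem hE).
have q0 : pos q by exact: (pos_idem hE).
have [] // := pos_sandwich0 hE q0 p0 _.
have <- : q * (1 - q - p) * q = - (q * p * q).
  by rewrite mulrBr mulrBr mulr1 qq subrr sub0r mulNr.
exact: (ering_quad hE).
Qed.

Lemma compatible_commute p q : compatible E p q -> p * q = q * p.
Proof.
move=> [p1 [q1 [r [[/projectionsP[Gp pp] /projectionsP[Gq qq]]]]]].
move=> /projectionsP[Gr rr] [[pq pr qr] [[_ ->] [_ ->]]].
have [pq0 qp0] := orthogonal_mul Gp pp Gq qq pq.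
have [pr0 rp0] := orthogonal_mul Gp pp Gr rr pr.
have [qr0 rq0] := orthogonal_mul Gq qq Gr rr qr.
by rewrite !mulrDl !mulrDr pq0 qp0 pr0 rp0 qr0 rq0.
Qed.

(** An upper bound [y] among projections absorbs [p] and [q] on both sides, so [y - (p + q)] is
    idempotent and hence positive. *)
Lemma orthogonal_sum_sup p q : G p -> p * p = p -> G q -> q * q = q ->
  p * q = 0 -> q * p = 0 ->
  is_sup_in E (projections E) [set p; q] (p + q).
Proof.
move=> Gp pp Gq qq pq qp.
have pqpq : (p + q) * (p + q) = p + q.
  by rewrite mulrDl !mulrDr pp qq pq qp addr0 add0r.
split=> [|a [->|->]|y /projectionsP[Gy yy] yub].
- by apply/projectionsP; split=> //; exact: GD.
- by rewrite /ele addrAC subrr add0r; exact: (pos_idem hE).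
- by rewrite /ele addrK; exact: (pos_idem hE).
have G'y : G (1 - y) by exact/GB/Gy/(G1 hE).
have y'y' := idem_compl yy.
have [|py yp] := orthogonal_mul Gp pp G'y y'y'.
  by rewrite /Defs.orthogonal subKr; apply: yub; left.
have [|qy yq] := orthogonal_mul Gq qq G'y y'y'.
  by rewrite /Defs.orthogonal subKr; apply: yub; right.
move/eqP: py; rewrite mulrBr mulr1 subr_eq0 => /eqP py.
move/eqP: yp; rewrite mulrBl mul1r subr_eq0 => /eqP yp.
move/eqP: qy; rewrite mulrBr mulr1 subr_eq0 => /eqP qy.
move/eqP: yq; rewrite mulrBl mul1r subr_eq0 => /eqP yq.
apply: (pos_idem hE); first exact/GB/GD.
rewrite mulrBl mulrBr (mulrBr (p + q)) yy mulrDr mulrDl pqpq.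
by rewrite -py -yp -qy -yq subrr subr0.
Qed.

(** The common part is [r = p * q], and [p - r], [q - r] are the two remainders. *)
Lemma commute_compatible p q : projections E p -> projections E q ->
  p * q = q * p -> compatible E p q.
Proof.
move=> /projectionsP[Gp pp] /projectionsP[Gq qq] pq.
pose r := p * q.
have Gr : G r by exact: (GM hE hG).
have rr : r * r = r.
  by rewrite /r {2}pq mulrA -[p * q * q]mulrA qq -mulrA -pq mulrA pp.
have pr : p * r = r by rewrite /r mulrA pp.
have rp : r * p = r by rewrite /r -mulrA -pq mulrA pp.
have qr : q * r = r by rewrite /r pq mulrA qq.
have rq : r * q = r by rewrite /r -mulrA qq.
have p1 : (p - r) * (p - r) = p - r.
  by rewrite mulrBl !mulrBr pp pr rp rr subrr subr0.
have q1 : (q - r) * (q - r) = q - r.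
  by rewrite mulrBl !mulrBr qq qr rq rr subrr subr0.
have Gp1 : G (p - r) by exact: GB.
have Gq1 : G (q - r) by exact: GB.
have pr1 : (p - r) * r = 0 by rewrite mulrBl pr rr subrr.
have rp1 : r * (p - r) = 0 by rewrite mulrBr rp rr subrr.
have qr1 : (q - r) * r = 0 by rewrite mulrBl qr rr subrr.
have rq1 : r * (q - r) = 0 by rewrite mulrBr rq rr subrr.
have pq1 : (p - r) * (q - r) = 0 by rewrite mulrBl !mulrBr pr rq rr !subrr.
have qp1 : (q - r) * (p - r) = 0.
  by rewrite mulrBl !mulrBr qr rp rr -pq !subrr.
have orth a b : G a -> a * a = a -> G b -> b * b = b ->
    a * b = 0 -> b * a = 0 -> Defs.orthogonal E a b.
  move=> Ga aa Gb bb ab ba; rewrite /Defs.orthogonal /ele -addrA -opprD.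
  apply: (pos_idem_compl hE); first exact: GD.
  by rewrite mulrDl !mulrDr aa bb ab ba addr0 add0r addrC.
exists (p - r), (q - r), r; split; first by split; exact/projectionsP.
split; first by split; exact: orth.
by split; rewrite subrK; split=> //;
  [rewrite -{2}[p](subrK r)|rewrite -{2}[q](subrK r)];
  exact: orthogonal_sum_sup.
Qed.

Lemma block_commute B b c : is_block E B -> B b -> B c -> b * c = c * b.
Proof. by move=> [_ Bc _] Bb Bc'; exact/compatible_commute/Bc. Qed.

(** A projection commuting with [B] can be added to [B] without losing pairwise compatibility, so by
    maximality it already belongs to [B]. *)
Lemma block_idempotents B : is_block E B ->
  idempotents_in (commutant E B) = B.
Proof.
move=> hB; have [BP Bcomp Bmax] := hB; rewrite eqEsubset.
split=> [p [[Gp pB] pp]|p Bp].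
  suff <- : B `|` [set p] = B by right.
  have Pp : projections E p by [].
  apply: Bmax => [q [/BP|->] //|q r|q]; last by left.
  have sub x : (B `|` [set p]) x -> projections E x by move=> [/BP|->].
  move=> Bq Br; apply: commute_compatible; [exact: sub|exact: sub|].
  case: Bq Br => [Bq|->] [Br|->] //; first exact: block_commute Bq Br.
    exact/esym/pB.
  exact: pB.
have [Gp pp] := BP _ Bp.
by split=> //; split=> // b Bb; exact: block_commute Bp Bb.
Qed.

(** [B] commutes with [g], so each projection in the bicommutant of [g] commutes with [B], lies in
    [B], and therefore commutes with [h]. *)
Lemma block_commutant_commute B g h : is_block E B ->
  commutant E B g -> commutant E B h -> h * g = g * h.
Proof.
move=> hB [Gg gB] [Gh hB']; apply: commute_of_projections => // p Gp pp pC.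
apply: hB'; rewrite -(block_idempotents hB).
split; last by rewrite expr2 pp.
split=> // b Bb; apply/esym/pC; last by rewrite gB.
by have [BP _ _] := hB; case: (BP _ Bb).
Qed.

End Blocks.

(** * The e-ring of a C-block *)

Section CBlock.
Context {R : nzRingType} {E : set R} (hE : is_ering E) (hG : is_AH_algebra E).
Context {B : set R} (hB : is_block E B).
Implicit Types (a b e f g h k p q x y : R).
Local Notation pos := (eplus E).
Local Notation G := (dirgroup E).
Local Notation half := (onehalf E).
Local Notation H := (commutant E B).

Lemma cblock_comm g h : H g -> H h -> g * h = h * g.
Proof. by move=> Hg Hh; exact: (block_commutant_commute hE hG hB). Qed.

Lemma cblockB g h : H g -> H h -> H (g - h).
Proof.
move=> [Gg gB] [Gh hB']; split; first exact: GB.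
by move=> b Bb; apply/esym/commute_sub; apply/esym; [exact: gB|exact: hB'].
Qed.

Lemma cblock1 : H 1.
Proof. by split; [exact: (G1 hE)|move=> b _; rewrite mul1r mulr1]. Qed.

Lemma cblock0 : H 0.
Proof. by rewrite -(subrr 1); exact/cblockB/cblock1/cblock1. Qed.

Lemma cblockN g : H g -> H (- g).
Proof. by rewrite -sub0r; apply: cblockB; exact: cblock0. Qed.

Lemma cblockD g h : H g -> H h -> H (g + h).
Proof. by move=> Hg /cblockN; rewrite -{2}[h]opprK; exact: cblockB. Qed.

Lemma cblockM g h : H g -> H h -> H (g * h).
Proof.
move=> Hg Hh; split.
  by apply: (GM hE hG); [case: Hg|case: Hh|exact: cblock_comm].
move=> b Bb; apply/esym/commute_mul; apply/esym; [exact: Hg.2|exact: Hh.2].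
Qed.

Lemma cblockMn g n : H g -> H (g *+ n).
Proof.
move=> Hg; elim: n => [|n IHn]; first exact: cblock0.
by rewrite mulrS; exact: cblockD.
Qed.

Lemma cblock_halfX n g : H g -> H (half ^+ n * g).
Proof.
move=> [Gg gB]; split; first exact: (G_halfX hE hG).
by move=> b Bb; apply/esym/commute_mul; [rewrite (halfXC hG)|rewrite gB].
Qed.

(** For the converse, [x] is at most some [n], hence at most [2 ^ n]; then [half ^+ n * x] is an
    effect in [H], and [x] is the sum of [2 ^ n] copies of it. *)
Lemma eplus_cblock x : eplus (E `&` H) x <-> pos x /\ H x.
Proof.
split=> [[n [e [He ->]]]|[x0 Hx]].
  split; first by exists n, e; split=> // i; case: (He i).
  elim: n e He => [|n IHn] e He; first by rewrite big_ord0; exact: cblock0.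
  by rewrite big_ord_recr; apply: cblockD; [exact: IHn|case: (He ord_max)].
have [n xn] := pos_bound hE x0.
rewrite -(halfX_double hG n x); apply/posMn/pos_effect; split.
  apply: (ering_effect hE); first exact: (pos_halfX hE hG).
  rewrite -[1](halfX_double hG n) -mulrnAr -mulrBr; apply: (pos_halfX hE hG).
  by apply: ele_trans xn _; apply: (ele_nat hE); exact/ltnW/ltn_expl.
exact: cblock_halfX.
Qed.

Lemma dirgroup_cblock : dirgroup (E `&` H) = H.
Proof.
rewrite eqEsubset; split=> [g [a [b []]]|g Hg].
  by move=> /eplus_cblock[_ Ha] /eplus_cblock[_ Hb] ->; exact: cblockB.
have [n [_ gn]] := G_bound2 hE Hg.1.
have Hn : H n%:R by exact/cblockMn/cblock1.
exists (g + n%:R), n%:R; split; last by rewrite addrK.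
  apply/eplus_cblock; split; last exact: cblockD.
  by move: gn; rewrite /ele opprK addrC.
by apply/eplus_cblock; split=> //; exact: (pos_nat hE).
Qed.

Lemma ele_cblock g h : H g -> H h -> (ele (E `&` H) g h <-> ele E g h).
Proof.
move=> Hg Hh; split=> [/eplus_cblock[]|gh] //.
by apply/eplus_cblock; split=> //; exact: cblockB.
Qed.

Lemma ering_cblock : is_ering (E `&` H).
Proof.
split.
- by split; [exact: (ering0 hE)|exact: cblock0].
- by split; [exact: (ering1 hE)|exact: cblock1].
- move=> e [Ee He]; split; first exact: (ering_compl hE).
  exact: cblockB cblock1 He.
- move=> a /eplus_cblock[a0 _] /eplus_cblock[na0 _].
  exact: (ering_pointed hE).
- move=> a /eplus_cblock[a0 Ha] /eplus_cblock[a1 _]; split=> //.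
  exact: (ering_effect hE).
- move=> a b /eplus_cblock[a0 Ha] /eplus_cblock[b0 Hb] ab.
  by apply/eplus_cblock; split; [exact: (ering_mul hE)|exact: cblockM].
- move=> a b /eplus_cblock[a0 Ha] /eplus_cblock[b0 Hb].
  apply/eplus_cblock; split; first exact: (ering_quad hE).
  by apply: cblockM => //; exact: cblockM.
- move=> a b /eplus_cblock[a0 _] /eplus_cblock[b0 _].
  exact: (ering_quad0 hE).
- move=> a b /eplus_cblock[a0 Ha] /eplus_cblock[b0 Hb].
  apply/eplus_cblock; split; first exact: (ering_sqr hE).
  by rewrite expr2; apply: cblockM; exact: cblockB.
Qed.

Lemma cblock_sup (u : nat -> R) b :
  (forall n, H (u n)) -> (forall n, pos (u n.+1 - u n)) ->
  H b -> (forall n, pos (b - u n)) ->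
  exists g, [/\ H g, forall n, pos (g - u n) &
    forall y, G y -> (forall n, pos (y - u n)) -> pos (y - g)].
Proof.
move=> Hu uS Hb ub.
have [||||m n|g [Gg ug gmin gC]] := @monotone_sup _ _ hG u b.
- by move=> n; case: (Hu n).
- exact: uS.
- by case: Hb.
- exact: ub.
- exact: cblock_comm.
exists g; split=> //; split=> // c Bc; apply/esym/gC => [|n].
  by have [BP _ _] := hB; case: (BP _ Bc).
by apply/esym/(Hu n).2.
Qed.

(** All elements of [H] commute, so [cblock_sup] covers every ascending sequence and the bicommutant
    condition holds for any element of [H]. *)
Lemma vigier_cblock : vigier (E `&` H).
Proof.
move=> u [Hu uS [b Hb ub]]; rewrite /has_bicommuting_sup.
rewrite /bicommutant /commutant dirgroup_cblock -/(commutant E B) in Hu Hb *.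
have {}Hu n : H (u n) := Hu n.
have [n|n|g [Hg ug gmin]] := @cblock_sup u b Hu _ Hb _.
- exact/ele_cblock/uS.
- exact/ele_cblock/ub.
exists g; split.
  split=> // [_ [n _ <-]|y Hy yub]; first by apply/ele_cblock => //; exact: ug.
  apply/ele_cblock => //; apply: gmin => [|n]; first by case: Hy.
  by apply/ele_cblock => //; apply: yub; exists n.
by split=> // k [Hk _]; exact: cblock_comm.
Qed.

Lemma AH_algebra_cblock : is_AH_algebra (E `&` H).
Proof.
split.
- exists half; last by case: (half_spec hG).
  split; first by case: (half_spec hG).
  by rewrite -[half]mulr1 -[half]expr1; exact/cblock_halfX/cblock1.
- rewrite dirgroup_cblock => g h [Gg _] [Gh _].
  exact: (AH_quad_annihilation hG).
- by move=> u ub _; exact: vigier_cblock.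
Qed.

End CBlock.

(** * Real scalars *)

Section RealScalars.
Context {K : realType}.
Context {R : nzRingType} {E : set R} (hE : is_ering E) (hG : is_AH_algebra E).
Implicit Types (g h x y : R) (l m : K) (i j : int) (k n : nat).
Local Notation pos := (eplus E).
Local Notation G := (dirgroup E).
Local Notation half := (onehalf E).

(** Agreement at 1 cancels the integer part [t] of [m = l *+ 2 ^ n]. What remains of [phi m - psi m]
    lives on the fractional part and is at most [phi 1], uniformly in [n], so the archimedean
    property applies. *)
Lemma additive_pos_le (phi psi : K -> R) :
  {morph phi : l m / l + m} -> {morph psi : l m / l + m} ->
  (forall l, 0 <= l -> pos (phi l)) -> (forall l, 0 <= l -> pos (psi l)) ->
  phi 1 = psi 1 -> forall l, 0 <= l -> ele E (phi l) (psi l).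
Proof.
move=> phiD psiD phi0 psi0 phi1 l l0.
have nat_mul (f : K -> R) m n :
    {morph f : l m / l + m} -> f (m *+ n) = f m *+ n.
  move=> fD; elim: n => [|n IHn]; last by rewrite !mulrS fD IHn.
  by rewrite !mulr0n; apply: (addrI (f 0)); rewrite -fD !addr0.
rewrite /ele -opprB -sub0r; apply: (archimedean hE hG (b := phi 1)) => [||n].
- by apply: GB; apply: G_pos; [exact: phi0|exact: psi0].
- exact/G_pos/phi0.
rewrite mulrnBl -!nat_mul //; set m := l *+ 2 ^ n.
have m0 : 0 <= m by rewrite mulrn_wge0.
have /andP[tm mt] := truncn_itv m0; set t := Num.truncn m in tm mt.
have -> : m = (m - t%:R) + 1 *+ t by rewrite subrK.
rewrite phiD psiD !nat_mul // phi1.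
have -> : psi 1 = phi (1 - (m - t%:R)) + phi (m - t%:R).
  by rewrite -phiD subrK phi1.
rewrite /ele; set a := phi (1 - _); set b := phi (m - _); set c := psi (m - _).
have -> : a + b - (b + (a + b) *+ t - (c + (a + b) *+ t)) = a + c.
  by linear3 a b c.
apply: posD; last by apply: psi0; rewrite subr_ge0.
by apply: phi0; rewrite subr_ge0 lerBlDl -natr1 in mt *; exact: ltW.
Qed.

Lemma additive_pos_eq (phi psi : K -> R) :
  {morph phi : l m / l + m} -> {morph psi : l m / l + m} ->
  (forall l, 0 <= l -> pos (phi l)) -> (forall l, 0 <= l -> pos (psi l)) ->
  phi 1 = psi 1 -> phi =1 psi.
Proof.
move=> phiD psiD phi0 psi0 phi1 l.
have phipsi m : 0 <= m -> phi m = psi m.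
  by move=> m0; apply: (ele_anti hE); exact: additive_pos_le.
have l0 : 0 <= `|l| by [].
have l1 : 0 <= l + `|l| by rewrite addrC -lerBlDr sub0r -normrN ler_norm.
by apply: (addIr (phi `|l|)); rewrite -phiD phipsi // psiD phipsi.
Qed.

Lemma pos_intr i : 0 <= i -> pos i%:~R.
Proof. by case: i => // n _; exact: (pos_nat hE). Qed.

Lemma half_intr_le i n j k : i * (2 ^ k)%:Z <= j * (2 ^ n)%:Z ->
  ele E (half ^+ n * i%:~R) (half ^+ k * j%:~R).
Proof.
move=> ij; apply: (pos_pow2 hE hG (n := n + k)).
have intrMn (z : int) r : z%:~R *+ r = (z * r%:Z)%:~R :> R.
  by rewrite mulrzA -pmulrn.
rewrite mulrnBl [in X in X - _]expnD [in X in X - _]mulnC mulrnA.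
rewrite (halfX_double hG).
rewrite expnD mulrnA (halfX_double hG) !intrMn -mulrzBr.
by apply: pos_intr; rewrite subr_ge0.
Qed.

(* [x] is the multiple [l 1] of the unity, determined by the dyadic rationals *)
(* below and above [l].                                                       *)
Definition is_of_real (l : K) (x : R) : Prop :=
  [/\ G x, forall g, G g -> g * x = x * g &
    forall i n, (i%:~R <= l * 2 ^+ n -> ele E (half ^+ n * i%:~R) x) /\
                (l * 2 ^+ n <= i%:~R -> ele E x (half ^+ n * i%:~R))].

Lemma is_of_real_exists l : exists x, is_of_real l x.
Proof.
pose u n := half ^+ n * (Num.floor (l * 2 ^+ n))%:~R.
have uC n x : x * u n = u n * x.
  by apply: commute_mul; [rewrite (halfXC hG)|rewrite commr_int].
have Gu n : G (u n).
  apply: (G_halfX hE hG); case: (Num.floor _) => k; first exact: (G_nat hE).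
  by rewrite NegzE mulrNz; apply/GN/(G_nat hE).
(* A dyadic number below [l] and one above it are compared in [K]; the outcome is stated over the
   integers so that [half_intr_le] can transport it to [R]. *)
have cross i j n k : i%:~R <= l * 2 ^+ n -> l * 2 ^+ k <= j%:~R ->
    i * (2 ^ k)%:Z <= j * (2 ^ n)%:Z.
  move=> il lj; rewrite -(ler_int K) !intrM.
  have -> : ((2 ^ k)%:Z)%:~R = 2 ^+ k :> K by rewrite -natrX.
  have -> : ((2 ^ n)%:Z)%:~R = 2 ^+ n :> K by rewrite -natrX.
  apply: le_trans (_ : l * 2 ^+ n * 2 ^+ k <= _).
    by rewrite ler_wpM2r // exprn_ge0.
  by rewrite mulrAC ler_wpM2r // exprn_ge0.
have uub i n k : l * 2 ^+ k <= i%:~R -> ele E (u n) (half ^+ k * i%:~R).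
  by move=> li; apply: half_intr_le; apply: cross => //; exact: floor_le.
have [n||n|n k|x [Gx ux xmin xC]] := @monotone_sup _ _ hG u
    (half ^+ 0 * (Num.floor l + 1)%:~R) Gu.
- apply: half_intr_le; rewrite expnS PoszM mulrA.
  rewrite ler_wpM2r // floor_ge_int intrM exprSr mulrA.
  by rewrite ler_wpM2r // floor_le.
- apply: (G_halfX hE hG); case: (Num.floor _ + 1) => k; first exact: (G_nat hE).
  by rewrite NegzE mulrNz; apply/GN/(G_nat hE).
- by apply: uub; rewrite expr0 mulr1 ltW // floorD1_gt.
- exact: uC.
exists x; split=> // [g Gg|i n].
  by apply: xC => // n; exact: uC.
split=> li.
  apply: ele_trans (ux n); apply: half_intr_le.
  by rewrite ler_wpM2r // floor_ge_int.
apply: xmin => [|k]; last exact: uub.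
apply: (G_halfX hE hG); case: (i) => k; first exact: (G_nat hE).
by rewrite NegzE mulrNz; apply/GN/(G_nat hE).
Qed.

Definition of_real l : R := xget 0 (is_of_real l).

Lemma of_realP l : is_of_real l (of_real l).
Proof. by apply: (@xgetPex _ 0 (is_of_real l)); exact: is_of_real_exists. Qed.

Lemma of_realG l : G (of_real l). Proof. by case: (of_realP l). Qed.

Lemma of_realC l g : G g -> g * of_real l = of_real l * g.
Proof. by case: (of_realP l) => _ + _; apply. Qed.

Lemma of_real_ge0 l : 0 <= l -> pos (of_real l).
Proof.
case: (of_realP l) => _ _ lP l0; have [+ _] := lP 0 0%N.
by rewrite expr0 mulr1 mulr0 => /(_ l0); rewrite /ele subr0.
Qed.

Lemma of_real1 : of_real 1 = 1.
Proof.
case: (of_realP 1) => _ _ lP; have [+ +] := lP 1 0%N.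
rewrite !expr0 !mulr1 => /(_ (lexx _)) l1 /(_ (lexx _)) l2.
exact: (ele_anti hE).
Qed.

(** For each [n], the floors of [l * 2 ^+ n] and [m * 2 ^+ n] enclose both sides in one interval of
    length [half ^+ n * 2]; the archimedean property then identifies them. *)
Lemma of_realD : {morph of_real : l m / l + m}.
Proof.
move=> l m; set x := of_real _; set y := of_real l; set z := of_real m.
have bounds n : exists2 a, ele E a x /\ ele E x (a + half ^+ n * 2) &
    ele E a (y + z) /\ ele E (y + z) (a + half ^+ n * 2).
  have [_ _ xP] := of_realP (l + m).
  have [_ _ yP] := of_realP l; have [_ _ zP] := of_realP m.
  pose i := Num.floor (l * 2 ^+ n); pose j := Num.floor (m * 2 ^+ n).
  have li := floor_le (l * 2 ^+ n); have mj := floor_le (m * 2 ^+ n).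
  have /ltW il := floorD1_gt (l * 2 ^+ n).
  have /ltW jm := floorD1_gt (m * 2 ^+ n).
  rewrite -/i -/j in li mj il jm.
  exists (half ^+ n * (i + j)%:~R).
    split; first by apply: (xP _ _).1; rewrite intrD mulrDl lerD.
    have -> : half ^+ n * (i + j)%:~R + half ^+ n * 2 =
              half ^+ n * (i + 1 + (j + 1))%:~R :> R.
      by rewrite -mulrDr addrACA [in RHS]intrD.
    by apply: (xP _ _).2; rewrite intrD mulrDl lerD.
  split.
    have := posD ((yP i n).1 li) ((zP j n).1 mj).
    by rewrite /ele addrACA -opprD -mulrDr -intrD.
  have := posD ((yP (i + 1) n).2 il) ((zP (j + 1) n).2 jm).
  rewrite /ele addrACA -opprD -mulrDr -intrD -addrACA.
  by rewrite [in X in half ^+ n * X]intrD mulrDr.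
have le a b : G a -> G b ->
    (forall n, exists2 c, ele E c b & ele E a (c + half ^+ n * 2)) ->
    ele E a b.
  move=> Ga Gb ab; rewrite /ele -opprB -sub0r.
  apply: (archimedean hE hG (b := 2)) => [||n]; [exact: GB|exact: (G_nat hE)|].
  have [c cb ac] := ab n; rewrite -[2](halfX_double hG n) /ele -mulrnBl.
  apply: posMn.
  have -> : half ^+ n * 2 - (a - b) = (b - c) + (c + half ^+ n * 2 - a).
    by linear4 a b c (half ^+ n * 2).
  exact: posD.
have Gx := of_realG (l + m); have Gyz := GD (of_realG l) (of_realG m).
by apply: (ele_anti hE); apply: le => // n;
  have [a [? ?] [? ?]] := bounds n; exists a.
Qed.

(** For fixed [m >= 0] both sides are additive and positive in [l] and agree at 1, so
    [additive_pos_eq] applies; a general [m] is a difference of nonnegative reals. *)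
Lemma of_realM : {morph of_real : l m / l * m}.
Proof.
have pos_case l m : 0 <= m -> of_real (l * m) = of_real l * of_real m.
  move=> m0; apply: (@additive_pos_eq (fun l => of_real (l * m))
    (fun l => of_real l * of_real m)).
  - by move=> l1 l2; rewrite mulrDl of_realD.
  - by move=> l1 l2; rewrite of_realD mulrDl.
  - by move=> l1 l10; apply/of_real_ge0/mulr_ge0.
  - move=> l1 l10; apply: (posM hE); [exact: of_real_ge0|exact: of_real_ge0|].
    exact/of_realC/of_realG.
  - by rewrite mul1r of_real1 mul1r.
move=> l m.
have m0 : 0 <= `|m| by [].
have m1 : 0 <= m + `|m| by rewrite addrC -lerBlDr sub0r -normrN ler_norm.
apply: (addIr (of_real (l * `|m|))).
by rewrite -of_realD -mulrDr pos_case // of_realD mulrDr [in RHS]pos_case.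
Qed.

Lemma of_real0 : of_real 0 = 0.
Proof. by apply: (addrI (of_real 0)); rewrite -of_realD !addr0. Qed.

Lemma of_realN l : of_real (- l) = - of_real l.
Proof. by apply/eqP; rewrite -addr_eq0 -of_realD addNr of_real0. Qed.

Lemma of_realB l m : of_real (l - m) = of_real l - of_real m.
Proof. by rewrite of_realD of_realN. Qed.

Lemma ordered_scaling_of_real : ordered_scaling E (fun l g => of_real l * g).
Proof.
split; last first.
  move=> l g l0 Gg; rewrite /ele !subr0 => g0.
  by apply: (posM hE) => //; [exact: of_real_ge0|exact/esym/of_realC].
split.
- exact: G0.
- by move=> x y; exact: GB.
- move=> l x Gx; apply: (GM hE hG) => //; first exact: of_realG.
  exact/esym/of_realC.
- by move=> l x y _ _; rewrite mulrDr.
- by move=> l m x _; rewrite of_realD mulrDl.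
- by move=> l m x _; rewrite of_realM mulrA.
- by move=> x _; rewrite of_real1 mul1r.
Qed.

(** For fixed positive [g], both sides are additive positive functions of [l] that agree at 1; a
    general [g] is a difference of positive elements. *)
Lemma ordered_scaling_unique (scal : K -> R -> R) : ordered_scaling E scal ->
  forall l g, G g -> scal l g = of_real l * g.
Proof.
move=> [[_ _ sZ sDr sDl _ s1] s0].
have pos_case l g : pos g -> scal l g = of_real l * g.
  move=> g0; have Gg := G_pos g0.
  apply: (@additive_pos_eq (scal^~ g) (fun l => of_real l * g)).
  - by move=> l1 l2; exact: sDl.
  - by move=> l1 l2; rewrite of_realD mulrDl.
  - move=> m m0; have := s0 m g m0 Gg; rewrite /ele !subr0; exact.
  - move=> m m0; apply: (posM hE) => //; first exact: of_real_ge0.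
    exact/esym/of_realC.
  - by rewrite s1 // of_real1 mul1r.
move=> l g Gg; have [a [b [a0 b0 gE]]] := Gg.
have Gb := G_pos b0.
apply: (addIr (scal l b)); rewrite -sDr //.
by rewrite [in LHS]gE subrK !pos_case // -mulrDr [in RHS]gE subrK.
Qed.

End RealScalars.

Arguments of_real {K R} E l.

(** * The 1-norm *)

Section OneNorm.
Context {K : realType}.
Context {R : nzRingType} {E : set R} (hE : is_ering E) (hG : is_AH_algebra E).
Context {scal : K -> R -> R} (hs : ordered_scaling E scal).
Implicit Types (g h x y : R) (l m : K) (k n : nat).
Local Notation pos := (eplus E).
Local Notation G := (dirgroup E).
Local Notation norm := (one_norm E scal).
Local Notation c := (@of_real K R E).

Let scalE := ordered_scaling_unique hE hG hs.
Let cD := of_realD hE hG (K := K).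
Let cB := of_realB hE hG (K := K).
Let cM := of_realM hE hG (K := K).
Let c0 := of_real0 hE hG (K := K).
Let c1 := of_real1 hE hG (K := K).
Let c_ge0 := @of_real_ge0 K R E hE hG.
Let cG := @of_realG K R E hE hG.
Let cC := @of_realC K R E hE hG.

(** The infimum is attained: [S] has elements below [l + 2 ^- n] for every [n], and the archimedean
    property removes the error [2 ^- n]. *)
Lemma one_norm_leP g l : G g ->
  norm g <= l <-> [/\ 0 <= l, pos (c l - g) & pos (c l + g)].
Proof.
move=> Gg; rewrite /one_norm; set S := [set _ | _].
have SE m : S m <-> [/\ 0 <= m, pos (c m - g) & pos (c m + g)].
  rewrite /S /= /ele scalE ?mulr1; last exact: (G1 hE).
  by rewrite opprK [g + _]addrC; split=> -[].
have cn n : c n%:R = n%:R.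
  elim: n => [|n IHn]; first exact: c0.
  by rewrite -!natr1 cD c1 IHn.
have S0 : S !=set0.
  have [n [gn gn']] := G_bound2 hE Gg; exists n%:R; apply/SE.
  by rewrite cn; split=> //; move: gn'; rewrite /ele opprK.
have Slb : lbound S 0 by move=> m /SE[].
split=> [Sl|/SE]; last by apply: ge_inf; exists 0.
have Seps n : exists2 m, S m & m <= l + 2 ^- n.
  have [|m Sm ml] := @inf_lt _ S (l + 2 ^- n) S0.
    by apply: le_lt_trans Sl _; rewrite ltrDl invr_gt0 exprn_gt0.
  by exists m => //; exact: ltW.
have c2n n : c (2 ^- n) *+ 2 ^ n = 1.
  rewrite -[c _ *+ _]mulr_natr -(cn (2 ^ n)%N) -cM natrX mulVf ?c1 //.
  by rewrite expf_neq0 // pnatr_eq0.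
have close h : G h -> (forall n, pos (c (l + 2 ^- n) - h)) -> pos (c l - h).
  move=> Gh lh; rewrite -opprB -sub0r.
  apply: (archimedean hE hG (b := 1)) => [||n]; [exact/GB/cG|exact: (G1 hE)|].
  rewrite /ele -(c2n n) -mulrnBl; apply: posMn.
  have := lh n; rewrite cD.
  suff -> : c l + c (2 ^- n) - h = c (2 ^- n) - (h - c l) by [].
  by linear3 (c l) (c (2 ^- n)) h.
have up x : G x -> (forall m, S m -> pos (c m - x)) -> pos (c l - x).
  move=> Gx Sx; apply: close => // n; have [m Sm ml] := Seps n.
  apply: ele_trans (Sx m Sm) _; rewrite /ele -cB.
  by apply: c_ge0; rewrite subr_ge0.
split; first by apply: le_trans Sl; exact: lb_le_inf.
  by apply: up => // m /SE[].
by rewrite -[g]opprK; apply: up => [|m /SE[]]; [exact: GN|rewrite opprK].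
Qed.

Lemma one_norm_bound g : G g ->
  [/\ 0 <= norm g, pos (c (norm g) - g) & pos (c (norm g) + g)].
Proof. by move=> Gg; apply/one_norm_leP. Qed.

Lemma one_norm_eq0 g : G g -> norm g = 0 -> g = 0.
Proof.
move=> Gg g0; have [_] := one_norm_bound Gg.
rewrite g0 c0 sub0r add0r => ng pg.
exact: (ering_pointed hE).
Qed.

Lemma one_norm0 : norm 0 = 0.
Proof.
have G0 := G0 (E := E).
apply/eqP; rewrite eq_le; apply/andP; split; last by case: (one_norm_bound G0).
by apply/one_norm_leP => //; rewrite c0 subr0 addr0; split=> //; exact: pos0.
Qed.

Lemma one_normN g : G g -> norm (- g) = norm g.
Proof.
have le h : G h -> norm (- h) <= norm h.
  move=> Gh; apply/one_norm_leP; first exact: GN.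
  by rewrite opprK; have [] := one_norm_bound Gh.
move=> Gg; apply/eqP; rewrite eq_le le //=.
by rewrite -{1}[g]opprK le //; exact: GN.
Qed.

Lemma G_of_real l g : G g -> G (c l * g).
Proof. by move=> Gg; apply: (GM hE hG) => //; exact/esym/cC. Qed.

Lemma one_normZ_le l g : G g -> norm (c l * g) <= `|l| * norm g.
Proof.
have nneg m h : 0 <= m -> G h -> norm (c m * h) <= m * norm h.
  move=> m0 Gh; have [h0 hl hu] := one_norm_bound Gh.
  apply/one_norm_leP; first exact: G_of_real.
  rewrite cM -mulrBr -mulrDr; split; first exact: mulr_ge0.
    apply: (posM hE) => //; first exact: c_ge0.
    by apply/esym/cC/GB.
  apply: (posM hE) => //; first exact: c_ge0.
  by apply/esym/cC/GD.
move=> Gg; have [l0|/ltW l0] := leP 0 l.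
  by rewrite ger0_norm //; exact: nneg.
rewrite ler0_norm // -(one_normN Gg) -[c l]opprK -(of_realN hE hG) mulNr -mulrN.
by apply: nneg; [rewrite oppr_ge0|exact: GN].
Qed.

(** The missing inequality is [one_normZ_le] for the inverse scalar, applied to [c l * g]. *)
Lemma one_normZ l g : G g -> norm (c l * g) = `|l| * norm g.
Proof.
move=> Gg; have [->|l0] := eqVneq l 0.
  by rewrite c0 mul0r one_norm0 normr0 mul0r.
apply/eqP; rewrite eq_le one_normZ_le //=.
have -> : g = c l^-1 * (c l * g) by rewrite mulrA -cM mulVf // c1 mul1r.
have := one_normZ_le l^-1 (G_of_real l Gg).
rewrite mulrA -cM mulVf // c1 mul1r normfV.
rewrite -(ler_pM2l (_ : 0 < `|l|)) ?normr_gt0 // mulrA mulfV ?normr_eq0 //.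
by rewrite mul1r.
Qed.

Lemma one_normD g h : G g -> G h -> norm (g + h) <= norm g + norm h.
Proof.
move=> Gg Gh; have [g0 gl gu] := one_norm_bound Gg.
have [h0 hl hu] := one_norm_bound Gh.
apply/one_norm_leP; first exact: GD.
rewrite cD; split; first exact: addr_ge0.
  by rewrite opprD addrACA; exact: posD.
by rewrite addrACA; exact: posD.
Qed.

(* [2 (l m - g h) = (l - g)(m + h) + (l + g)(m - h)] and                      *)
(* [2 (l m + g h) = (l - g)(m - h) + (l + g)(m + h)].                         *)
Lemma one_normM g h : G g -> G h -> g * h = h * g ->
  norm (g * h) <= norm g * norm h.
Proof.
move=> Gg Gh gh; have [g0 gl gu] := one_norm_bound Gg.
have [h0 hl hu] := one_norm_bound Gh.
apply/one_norm_leP; first exact: (GM hE hG).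
rewrite cM; set l := c (norm g) in gl gu *; set m := c (norm h) in hl hu *.
have lg : l * g = g * l by exact/esym/cC.
have lh : l * h = h * l by exact/esym/cC.
have mg : m * g = g * m by exact/esym/cC.
have mh : m * h = h * m by exact/esym/cC.
have lm : l * m = m * l by exact/esym/cC/cG.
have prod x y : x * y = y * x -> x * m = m * x -> l * y = y * l ->
    pos (l + x) -> pos (m + y) -> pos ((l + x) * (m + y)).
  move=> xy xm ly x0 y0; apply: (posM hE) => //.
  by rewrite mulrDl !mulrDr !mulrDl lm xm ly xy addrACA.
split; first exact: mulr_ge0.
  apply: (pos_double hE hG).
  have -> : l * m - g * h + (l * m - g * h) =
      (l - g) * (m + h) + (l + g) * (m - h).
    rewrite !mulrDl !mulrDr !mulNr !mulrN.
    by linear4 (l * m) (l * h) (g * m) (g * h).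
  by apply: posD; apply: prod => //; rewrite ?mulNr ?mulrN ?gh ?mg ?lh.
apply: (pos_double hE hG).
have -> : l * m + g * h + (l * m + g * h) =
    (l - g) * (m - h) + (l + g) * (m + h).
  rewrite !mulrDl !mulrDr !mulNr !mulrN.
  by linear4 (l * m) (l * h) (g * m) (g * h).
by apply: posD; apply: prod => //; rewrite ?mulNr ?mulrN ?gh ?mg ?lh.
Qed.

(** Were the norm smaller than 1, [c (1 - norm 1)] would be positive together with its opposite,
    hence 0; but [c] sends a nonzero real to an invertible element, and [1 != 0] in [R]. *)
Lemma one_norm1 : norm 1 = 1.
Proof.
have G1 := G1 hE; apply/eqP; rewrite eq_le; apply/andP; split.
  apply/one_norm_leP => //; rewrite c1 subrr; split=> //; first exact: pos0.
  by apply: posD; exact: (pos1 hE).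
have [n0 n1 _] := one_norm_bound G1; rewrite leNgt; apply/negP => nlt.
have d0 : 0 < 1 - norm 1 by rewrite subr_gt0.
have cd : c (1 - norm 1) = 0.
  apply: (ering_pointed hE); first exact/c_ge0/ltW.
  by rewrite cB c1 opprB.
have /eqP := oner_neq0 R; apply.
by rewrite -c1 -(mulfV (lt0r_neq0 d0)) cM cd mul0r.
Qed.

(* [2 l g <= l ^ 2 + g ^ 2] *)
Lemma le_of_sqr_le g l : G g -> 0 < l -> pos (c (l ^+ 2) - g ^+ 2) ->
  pos (c l - g).
Proof.
move=> Gg l0 gl; have gc := cC l Gg.
have h0 : pos (c l * (c l - g)).
  apply: (pos_double hE hG); rewrite expr2 cM in gl.
  have -> : c l * (c l - g) + c l * (c l - g) =
            (c l - g) * (c l - g) + (c l * c l - g ^+ 2) by comm_ring2 gc.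
  by apply: posD gl; apply: (pos_sqr hE); exact: GB.
have -> : c l - g = c l^-1 * (c l * (c l - g)).
  by rewrite mulrA -cM mulVf ?lt0r_neq0 // c1 mul1r.
apply: (posM hE) => //; first by apply/c_ge0/ltW; rewrite invr_gt0.
by apply/esym/cC/G_of_real/GB.
Qed.

(** One inequality is submultiplicativity; for the other, [le_of_sqr_le] bounds [g] and [- g] by the
    square root of [l]. That lemma divides by its bound, so the case of norm 0 is settled separately
    by quadratic annihilation with 1. *)
Lemma one_norm_sqr g : G g -> norm (g ^+ 2) = norm g ^+ 2.
Proof.
move=> Gg; apply/eqP; rewrite eq_le {1}expr2 [leRHS]expr2 one_normM //=.
have Ggg : G (g ^+ 2) by rewrite expr2; exact: (GM hE hG).
have [gg0 ggl _] := one_norm_bound Ggg.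
have [g0 _ _] := one_norm_bound Gg.
have [n0|n0] := eqVneq (norm (g ^+ 2)) 0.
  suff -> : g = 0 by rewrite expr0n /= one_norm0 expr0n.
  have := AH_quad_annihilation hG (G1 hE) Gg.
  by rewrite (one_norm_eq0 Ggg n0) mulr0 mul0r mul1r => /(_ erefl)[].
set l := norm (g ^+ 2) in gg0 ggl n0 *.
have l0 : 0 < Num.sqrt l by rewrite sqrtr_gt0 lt0r n0.
have ll : Num.sqrt l ^+ 2 = l by rewrite sqr_sqrtr.
rewrite -ll ler_sqr ?nnegrE // ?sqrtr_ge0 //.
apply/one_norm_leP => //; split; first exact: sqrtr_ge0.
  by apply: le_of_sqr_le; rewrite ?ll.
rewrite -[g]opprK; apply: le_of_sqr_le => //; first exact: GN.
by rewrite sqrrN ll.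
Qed.

End OneNorm.

(** * Completeness of a C-block under the 1-norm *)

Section Completeness.
Context {K : realType}.
Context {R : nzRingType} {E : set R} (hE : is_ering E) (hG : is_AH_algebra E).
Context {scal : K -> R -> R} (hs : ordered_scaling E scal).
Context {B : set R} (hB : is_block E B).
Local Notation pos := (eplus E).
Local Notation G := (dirgroup E).
Local Notation H := (commutant E B).
Local Notation norm := (one_norm E scal).
Local Notation c := (@of_real K R E).

Lemma cblock_of_real (l : K) : H (c l).
Proof.
split; first exact: (of_realG hE hG).
move=> b Bb; apply/esym/(of_realC hE hG).
by have [BP _ _] := hB; case: (BP _ Bb).
Qed.

(** The 3 is the final error of [cblock_complete]: [2 ^- k] for the oscillation of [u] beyond [M k],
    plus twice [2 ^- k] for the shift in [v k]. *)
Lemma invrX2_le (e : K) : 0 < e -> exists k, 3 * 2 ^- k <= e.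
Proof.
move=> e0; pose k := Num.truncn (3 / e); exists k.
rewrite ler_pdivrMr ?exprn_gt0 // mulrC -ler_pdivrMr //.
apply: le_trans (ltW (truncnS_gt _)) _.
by rewrite -natrX ler_nat -/k; exact: ltn_expl.
Qed.

(* Along a subsequence [v k] with increments at most [2 ^- k], the elements   *)
(* [v k - 2 * 2 ^- k] ascend; their supremum is the limit.                    *)
Lemma cblock_complete : norm_complete H norm.
Proof.
move=> u Hu cauchy.
have e0 k : 0 < 2 ^- k :> K by rewrite invr_gt0 exprn_gt0.
have [M MP] := choice (fun k => cauchy _ (e0 k)).
(* Summing the thresholds gives indices that are nondecreasing and such that [N j] dominates [M k]
   for every [j >= k]. *)
pose N k := (\sum_(i < k.+1) M i)%N.
have NS k : N k.+1 = (N k + M k.+1)%N by rewrite /N big_ord_recr.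
have Nge k j : (M k <= N (j + k))%N.
  elim: j => [|j IHj]; last by rewrite addSn NS (leq_trans IHj) // leq_addr.
  by rewrite add0n /N big_ord_recr leq_addl.
have Gu n : G (u n) by case: (Hu n).
have near k i j : (M k <= i)%N -> (M k <= j)%N ->
    pos (u i + c (2 ^- k) - u j).
  move=> ki kj; have Gij : G (u j - u i) by exact: GB.
  have /ltW := MP k j i kj ki.
  case/(one_norm_leP hE hG hs _ Gij) => _ + _.
  by rewrite opprB addrCA addrA.
pose v k := u (N k) - c (2 * 2 ^- k).
(* The shift shrinks by exactly [2 ^- k] from [v k] to [v k.+1], which compensates the largest
   possible drop of [u] between [N k] and [N k.+1]. *)
have vS k : pos (v k.+1 - v k).
  have -> : v k.+1 - v k = u (N k.+1) + c (2 ^- k) - u (N k).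
    rewrite /v; have -> : c (2 * 2 ^- k) = c (2 * 2 ^- k.+1) + c (2 ^- k).
      rewrite -(of_realD hE hG); congr c.
      by rewrite exprS invfM mulrA mulfV ?pnatr_eq0 // mul1r mulr_natl mulr2n.
    by linear4 (u (N k.+1)) (u (N k)) (c (2 * 2 ^- k.+1)) (c (2 ^- k)).
  by apply: near; [rewrite -add1n; exact: Nge|exact: (Nge k 0%N)].
have vge j k : pos (v (j + k)%N - v k).
  elim: j => [|j IHj]; first by rewrite add0n subrr; exact: pos0.
  exact: ele_trans IHj (vS _).
have Hv k : H (v k) by apply: cblockB => //; exact: cblock_of_real.
have cpos (l : K) : 0 <= l -> pos (c l) by exact: (of_real_ge0 hE hG).
(* Each late [u j], raised by [2 ^- k], bounds the whole sequence [v]: this bounds the supremum [x]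
   above in terms of [u j]. *)
have vub m k j : (M k <= j)%N -> pos (u j + c (2 ^- k) - v m).
  move=> kj; have := vge k m; rewrite addnC => vm.
  apply: ele_trans vm _; rewrite /ele /v opprB addrCA; apply: posD.
    by apply: cpos; rewrite mulr_ge0 // ltW.
  exact: near.
have Hb : H (u (M 0%N) + c (2 ^- 0)).
  by apply: cblockD => //; exact: cblock_of_real.
have [x [Hx vx xmin]] :=
  cblock_sup hE hG hB Hv vS Hb (fun k => vub k 0%N _ (leqnn _)).
have [Gx _] := Hx.
exists x => //; apply/cvgr0Pnorm_le => e /invrX2_le[k ke].
exists (M k) => // j /= kj.
have Gux : G (u j - x) by exact: GB.
rewrite ger0_norm; last by case: (one_norm_bound hE hG hs Gux).
apply: le_trans ke; apply/(one_norm_leP hE hG hs) => //.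
split; first by rewrite mulr_ge0 // ltW.
  have -> : c (3 * 2 ^- k) - (u j - x) =
      (u (N k) + c (2 ^- k) - u j) + (x - v k).
    have -> : 3 * 2 ^- k = 2 ^- k + 2 * 2 ^- k :> K by rewrite mulrDl mul1r.
    rewrite (of_realD hE hG) /v; set a := c (2 ^- k); set b := c (_ * _).
    by linear5 a b (u j) x (u (N k)).
  by apply: posD => //; apply: near => //; exact: (Nge k 0%N).
have -> : c (3 * 2 ^- k) + (u j - x) = (u j + c (2 ^- k) - x) + c (2 * 2 ^- k).
  have -> : 3 * 2 ^- k = 2 ^- k + 2 * 2 ^- k :> K by rewrite mulrDl mul1r.
  rewrite (of_realD hE hG); linear4 (c (2 ^- k)) (c (2 * 2 ^- k)) (u j) x.
apply: posD; last by apply: cpos; rewrite mulr_ge0 // ltW.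
by apply: xmin => [|m]; [apply: GD => //; exact: (of_realG hE hG)|exact: vub].
Qed.

End Completeness.

Theorem theorem8p3 (K : realType) (R : nzRingType) (E H : set R)
    (hE : is_ering E) (hG : is_AH_algebra E) (hH : is_cblock E H) :
  (is_ering (E `&` H) /\ dirgroup (E `&` H) = H) /\
  (forall g h : R, H g -> H h -> (ele (E `&` H) g h <-> ele E g h)) /\
  (is_block E (idempotents_in H) /\ H = commutant E (idempotents_in H)) /\
  (is_AH_algebra (E `&` H) /\ vigier (E `&` H)) /\
  (* the real vector space structure of the AH-algebra G *)
  (exists scal : K -> R -> R, ordered_scaling E scal) /\
  (forall scal : K -> R -> R, ordered_scaling E scal ->
     is_comm_Banach_algebra H scal (one_norm E scal) /\
     (forall h : R, H h ->
        one_norm E scal (h ^+ 2) = one_norm E scal h ^+ 2)).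
Proof.
have [B [hB ->]] := hH.
split; first by split; [exact: ering_cblock|exact: dirgroup_cblock].
split; first by move=> g h; exact: ele_cblock.
(* The idempotents of [commutant E B] are [B] itself, so both claims reduce to the choice of [B]. *)
split; first by rewrite (block_idempotents hE hG hB).
split; first by split; [exact: AH_algebra_cblock|exact: vigier_cblock].
split.
  by exists (fun l g => of_real E l * g); exact: ordered_scaling_of_real.
move=> scal hs; split; last by move=> h [Gh _]; exact: one_norm_sqr.
have scalE := ordered_scaling_unique hE hG hs.
have Hc := cblock_of_real hE hG hB (K := K).
have HM g h := @cblockM _ _ hE hG _ hB g h.
split.
- have [sp _] := hs; split.
  + exact: cblock0.
  + by move=> x y; exact: cblockB.
  + by move=> l x Hx; rewrite scalE; [exact: HM|case: Hx].
  + by move=> l x y [Gx _] [Gy _]; exact: (vsZDr sp).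
  + by move=> l m x [Gx _]; exact: (vsZDl sp).
  + by move=> l m x [Gx _]; exact: (vsZA sp).
  + by move=> x [Gx _]; exact: (vs1Z sp).
- exact: cblock1.
- exact: HM.
- by move=> x y; exact: cblock_comm.
- by move=> x y z _ _ _; rewrite mulrA.
- move=> l x y Hx Hy; have [Gxy _] := HM x y Hx Hy.
  by rewrite !scalE ?mulrA //; case: Hx.
- move=> l x y Hx Hy; have [Gxy _] := HM x y Hx Hy; have [Gx _] := Hx.
  by rewrite !scalE //; [rewrite !mulrA (of_realC hE hG)|case: Hy].
- by move=> x [Gx _]; exact: one_norm_eq0.
- by move=> l x [Gx _]; rewrite scalE //; exact: one_normZ.
- by move=> x y [Gx _] [Gy _]; exact: one_normD.
- move=> x y Hx Hy; apply: one_normM => //; [by case: Hx|by case: Hy|].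
  exact: cblock_comm Hx Hy.
- exact: one_norm1.
- exact: cblock_complete.
Qed.
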